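(* Let $(\mathcal{D},g)$ be an oriented contact sub-Riemannian or sub-Lorentzian structure on a three-dimensional manifold $M$. Assume that $h=0$ and that $\kappa$ is constant. Let $c\in\mathbb{R}\setminus\{0\}$ and $\epsilon\in\mathbb{R}$. (i) If $\kappa=0$, then the pair $(G^c,2\epsilon c\alpha)$ defines an Einstein-Weyl structure on $M$ if and only if $g$ is sub-Lorentzian and $\epsilon^2=1$ (with $c\in\mathbb{R}\setminus\{0\}$ arbitrary). (ii) If $\kappa\neq 0$, then the pair $(G^c,2\epsilon c\alpha)$ defines an Einstein-Weyl structure on $M$ if and only if $$c=\frac{\kappa}{1+\epsilon^2}$$ when $g$ is sub-Riemannian, or $$\epsilon^2\neq 1\quad\text{and}\quad c=\frac{\kappa}{1-\epsilon^2}$$ when $g$ is sub-Lorentzian.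
   Context: All objects are smooth. A contact sub-Riemannian (resp. sub-Lorentzian) structure on a 3-manifold $M$ is a pair $(\mathcal{D},g)$ with $\mathcal{D}\subset TM$ a contact distribution (rank 2) and $g$ a metric on $\mathcal{D}$ that is positive-definite (resp. of signature $(-,+)$); it is oriented if an orientation of $\mathcal{D}$ is given. Let $(X_1,X_2)$ be a local positively oriented orthonormal frame of $\mathcal{D}$: $g(X_1,X_2)=0$, $g(X_2,X_2)=1$, and $g(X_1,X_1)=1$ in the sub-Riemannian case, $g(X_1,X_1)=-1$ in the sub-Lorentzian case. The Reeb vector field $X_0$ is the vector field such that $[X_0,X_i]$ is a section of $\mathcal{D}$ for $i=1,2$ and $[X_1,X_2]=X_0 \bmod \mathcal{D}$ (independent of the frame). The structural functions $c_{ij}^k$ are defined by $[X_0,X_1]=c_{01}^1X_1+c_{01}^2X_2$, $[X_0,X_2]=c_{02}^1X_1+c_{02}^2X_2$, $[X_1,X_2]=c_{12}^1X_1+c_{12}^2X_2+X_0$. $h=\frac12\mathcal{L}_{X_0}g$ is the symmetric bilinear form on $\mathcal{D}$ given by $h(X,Y)=\frac12\left(X_0(g(X,Y))-g([X_0,X],Y)-g(X,[X_0,Y])\right)$. The invariant $\kappa$ is the function $\kappa = X_1(c_{12}^2)-X_2(c_{12}^1)-(c_{12}^1)^2-(c_{12}^2)^2+\frac{1}{2}(c_{01}^2-c_{02}^1)$ in the sub-Riemannian case, and $\kappa = X_1(c_{12}^2)+X_2(c_{12}^1)+(c_{12}^1)^2-(c_{12}^2)^2+\frac{1}{2}(c_{01}^2+c_{02}^1)$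 in the sub-Lorentzian case. For $c\in\mathbb{R}\setminus\{0\}$, $G^c$ is the metric on $M$ which restricts to $g$ on $\mathcal{D}$ and satisfies $G^c(X_0,X_0)=c$, $G^c(X_0,X_i)=0$, $i=1,2$. The one-form $\alpha$ on $M$ is the one annihilating $\mathcal{D}$ with $\alpha(X_0)=1$. A Weyl structure on a 3-manifold is a pair $([G],\nabla)$ of a conformal class of (pseudo-)Riemannian metrics and a torsion-free linear connection with $\nabla G=\eta\otimes G$ for some one-form $\eta$; a pair $(G,\eta)$ determines $\nabla$ uniquely, and ''the Weyl structure given by $(G,\eta)$'' means $([G],\nabla)$ for this $\nabla$. It is Einstein-Weyl if $Ric(\nabla)_{sym}=\frac13 R_G\,G$, where $Ric(\nabla)_{sym}$ is the symmetric part of the Ricci tensor of $\nabla$ and $R_G$ is the scalar curvature of $\nabla$ with respect to $G$ (the $G$-trace of the Ricci tensor). *)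

(* Defs.v *)
From HB Require Import structures.
From mathcomp Require Import all_boot all_order all_algebra.
From mathcomp Require Import all_classical all_reals all_analysis.

Set Implicit Arguments.
Unset Strict Implicit.
Unset Printing Implicit Defensive.

Import Order.TTheory GRing.Theory Num.Theory.
Import numFieldNormedType.Exports.

Local Open Scope classical_set_scope.
Local Open Scope ring_scope.

Section Euclidean.
Context {R : realType}.
Implicit Types (A : set 'rV[R]_3) (f : 'rV[R]_3 -> R^o).

(* [Cn n A f] is meant for A open. *)
Fixpoint Cn (n : nat) A f : Prop :=
  match n with
  | 0 => forall x, A x -> {for x, continuous f}
  | n'.+1 => (forall x, A x -> differentiable f x) /\
             (forall v : 'rV[R]_3, Cn n' A (fun x => 'D_v f x))
  end.

Definition Cinfty A f : Prop := forall n, Cn n A f.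

End Euclidean.

Record chart (R : realType) (M : topologicalType) := Chart {
  cdom : set M;
  cmap : M -> 'rV[R]_3;
  cinv : 'rV[R]_3 -> M;
  cdom_open : open cdom;
  cimg_open : open (cmap @` cdom);
  cmapK : forall p, cdom p -> cinv (cmap p) = p;
  cmap_cont : forall p, cdom p -> {for p, continuous cmap};
  cinv_cont : forall x, (cmap @` cdom) x -> {for x, continuous cinv} }.

Record manifold3 (R : realType) := Manifold3 {
  carrier :> topologicalType;
  atlas : set (chart R carrier);
  carrier_nonempty : [set: carrier] !=set0;
  carrier_hausdorff : hausdorff_space carrier;
  carrier_countable : @second_countable carrier;
  atlas_cover : forall p : carrier, exists2 phi, atlas phi & cdom phi p;
  atlas_compat : forall phi psi, atlas phi -> atlas psi -> forall i : 'I_3,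
    Cinfty (cmap phi @` (cdom phi `&` cdom psi))
           (fun x => cmap psi (cinv phi x) 0 i) }.

Section Manifold.
Context {R : realType} (M : manifold3 R).

Definition smooth_on (U : set M) (f : M -> R) : Prop :=
  forall phi, atlas phi ->
    Cinfty (cmap phi @` (U `&` cdom phi)) (f \o cinv phi).

Definition smooth_at (p : M) (f : M -> R) : Prop :=
  exists U : set M, [/\ open U, U p & smooth_on U f].

(* A tangent vector at p is a functional on the functions smooth near p, namely
   a directional derivative in a chart.  It is extended by 0 to the other
   functions, so that equality of tangent vectors is equality of functionals
   and the vector space operations are the pointwise ones. *)
Definition tvec : Type := (M -> R) -> R^o.

Definition tangent (p : M) (v : tvec) : Prop :=
  forall phi, atlas phi -> cdom phi p -> exists a : 'rV[R]_3,
    forall f, v f = if `[< smooth_at p f >]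
                    then 'D_a (f \o cinv phi : _ -> R^o) (cmap phi p) else 0.

Definition vfield : Type := M -> tvec.

Definition app (X : vfield) (f : M -> R) : M -> R := fun p => X p f.

Definition smooth_vfield (U : set M) (X : vfield) : Prop :=
  (forall p, U p -> tangent p (X p)) /\
  (forall V f, open V -> V `<=` U -> smooth_on V f -> smooth_on V (app X f)).

Definition lie (X Y : vfield) : vfield := fun p f =>
  if `[< smooth_at p f >] then X p (app Y f) - Y p (app X f) else 0.

Definition free2 (v w : tvec) : Prop :=
  forall a b : R, a *: v + b *: w = 0 -> a = 0 /\ b = 0.

Definition basis3 (p : M) (e : 'I_3 -> tvec) : Prop :=
  [/\ forall i, tangent p (e i),
      forall a : 'I_3 -> R, \sum_i a i *: e i = 0 -> forall i, a i = 0
    & forall v, tangent p v -> exists a : 'I_3 -> R, v = \sum_i a i *: e i].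

Definition linear_on (V : set tvec) (l : tvec -> R) : Prop :=
  forall (a : R) v w, V v -> V w -> l (a *: v + w) = a * l v + l w.

Definition symbilinear_on (V : set tvec) (b : tvec -> tvec -> R) : Prop :=
  (forall v w, V v -> V w -> b v w = b w v) /\
  (forall w, V w -> linear_on V (b^~ w)).

Definition oneform (eta : M -> tvec -> R) : Prop :=
  (forall p, linear_on (tangent p) (eta p)) /\
  (forall U X, open U -> smooth_vfield U X ->
     smooth_on U (fun p => eta p (X p))).

Definition pseudo_metric (G : M -> tvec -> tvec -> R) : Prop :=
  [/\ forall p, symbilinear_on (tangent p) (G p),
      forall p v, tangent p v -> (forall w, tangent p w -> G p v w = 0) -> v = 0
    & forall U X Y, open U -> smooth_vfield U X -> smooth_vfield U Y ->
        smooth_on U (fun p => G p (X p) (Y p))].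

(* [nab p v Y] is the derivative of Y at p along v. *)
Definition connection : Type := M -> tvec -> vfield -> tvec.

Definition cov (nab : connection) (X Y : vfield) : vfield :=
  fun p => nab p (X p) Y.

(* The connection acts on vector fields defined near p.  Locality follows from
   the Leibniz rule, applied to a function f equal to 1 near p and 0 elsewhere,
   which is smooth near p. *)
Definition is_connection (nab : connection) : Prop :=
  [/\ forall U Y, open U -> smooth_vfield U Y -> forall p, U p ->
        forall (a : R) v w, tangent p v -> tangent p w ->
        nab p (a *: v + w) Y = a *: nab p v Y + nab p w Y,
      forall U Y Z, open U -> smooth_vfield U Y -> smooth_vfield U Z ->
        forall p v, U p -> tangent p v ->
        nab p v (fun q => Y q + Z q) = nab p v Y + nab p v Z,
      forall U f Y, open U -> smooth_on U f -> smooth_vfield U Y ->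
        forall p v, U p -> tangent p v ->
        nab p v (fun q => f q *: Y q) = f p *: nab p v Y + v f *: Y p
    & forall U X Y, open U -> smooth_vfield U X -> smooth_vfield U Y ->
        smooth_vfield U (cov nab X Y)].

Definition torsion_free (nab : connection) : Prop :=
  forall U X Y, open U -> smooth_vfield U X -> smooth_vfield U Y ->
  forall p, U p -> cov nab X Y p - cov nab Y X p = lie X Y p.

Definition metric_derivative (nab : connection) (G : M -> tvec -> tvec -> R)
    (X Y Z : vfield) (p : M) : R :=
  app X (fun q => G q (Y q) (Z q)) p
  - G p (cov nab X Y p) (Z p) - G p (Y p) (cov nab X Z p).

(* nab is the connection of the Weyl structure given by (G, eta). *)
Definition weyl_connection (G : M -> tvec -> tvec -> R) (eta : M -> tvec -> R)
    (nab : connection) : Prop :=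
  [/\ is_connection nab, torsion_free nab
    & forall U X Y Z, open U -> smooth_vfield U X -> smooth_vfield U Y ->
        smooth_vfield U Z -> forall p, U p ->
        metric_derivative nab G X Y Z p = eta p (X p) * G p (Y p) (Z p)].

Definition curvature_field (nab : connection) (X Y Z : vfield) : vfield :=
  fun p => cov nab X (cov nab Y Z) p - cov nab Y (cov nab X Z) p
           - cov nab (lie X Y) Z p.

(* The curvature tensor R(u, v) w at p, computed with arbitrary local
   extensions of u, v, w. *)
Definition curvature (nab : connection) (p : M) (u v w : tvec) : tvec :=
  xget 0 [set z : tvec | exists U X Y Z,
    [/\ open U, U p,
        [/\ smooth_vfield U X, smooth_vfield U Y & smooth_vfield U Z],
        [/\ X p = u, Y p = v & Z p = w]
      & z = curvature_field nab X Y Z p]].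

(* Trace of an endomorphism of the tangent space at p, in an arbitrary basis. *)
Definition trace (p : M) (L : tvec -> tvec) : R :=
  xget 0 [set t : R | exists (e : 'I_3 -> tvec) (A : 'M[R]_3),
    [/\ basis3 p e, forall i, L (e i) = \sum_j A i j *: e j & t = \tr A]].

Definition ricci (nab : connection) (p : M) (v w : tvec) : R :=
  trace p (fun u => curvature nab p u v w).

Definition ricci_sym (nab : connection) (p : M) (v w : tvec) : R :=
  (ricci nab p v w + ricci nab p w v) / 2.

Definition gram (b : tvec -> tvec -> R) (e : 'I_3 -> tvec) : 'M[R]_3 :=
  \matrix_(i, j) b (e i) (e j).

Definition scalar_curvature (G : M -> tvec -> tvec -> R) (nab : connection)
    (p : M) : R :=
  xget 0 [set t : R | exists2 e : 'I_3 -> tvec, basis3 p e &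
    t = \tr (invmx (gram (G p) e) *m gram (ricci nab p) e)].

Definition einstein_weyl (G : M -> tvec -> tvec -> R) (nab : connection) : Prop :=
  forall p v w, tangent p v -> tangent p w ->
    ricci_sym nab p v w = 1 / 3 * scalar_curvature G nab p * G p v w.

(* The connection is unique on smooth vector fields, as G is nondegenerate. *)
Definition defines_einstein_weyl (G : M -> tvec -> tvec -> R)
    (eta : M -> tvec -> R) : Prop :=
  exists2 nab, weyl_connection G eta nab & einstein_weyl G nab.

Definition frame_of (D : M -> set tvec) (U : set M) (X1 X2 : vfield) : Prop :=
  [/\ smooth_vfield U X1, smooth_vfield U X2
    & forall p, U p -> free2 (X1 p) (X2 p) /\
        (D p = [set v : tvec | exists a b : R, v = a *: X1 p + b *: X2 p])].

Definition distribution2 (D : M -> set tvec) : Prop :=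
  forall p, exists U X1 X2, [/\ open U, U p & frame_of D U X1 X2].

Definition contact (D : M -> set tvec) : Prop :=
  forall U X1 X2, open U -> frame_of D U X1 X2 ->
  forall p, U p -> ~ D p (lie X1 X2 p).

Definition section_of (D : M -> set tvec) (U : set M) (X : vfield) : Prop :=
  smooth_vfield U X /\ (forall p, U p -> D p (X p)).

(* An orientation of D, given by its positive bases: a smoothly varying choice
   of one of the two classes of bases of each plane D p. *)
Definition orientation (D : M -> set tvec) (pos : M -> tvec -> tvec -> Prop) :
    Prop :=
  [/\ forall p v w, pos p v w -> [/\ D p v, D p w & free2 v w],
      forall p v w, pos p v w -> forall a b c d : R, a * d - b * c != 0 ->
        (pos p (a *: v + b *: w) (c *: v + d *: w) <-> 0 < a * d - b * c)
    & forall p, exists U X1 X2, [/\ open U, U p, frame_of D U X1 X2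
        & forall q, U q -> pos q (X1 q) (X2 q)]].

End Manifold.

Inductive geometry := SubRiemannian | SubLorentzian.

Definition has_signature (R : realType) (M : manifold3 R) (s : geometry)
    (V : set (tvec M)) (b : tvec M -> tvec M -> R) : Prop :=
  match s with
  | SubRiemannian => forall v, V v -> v <> 0 -> 0 < b v v
  | SubLorentzian => exists v w,
      [/\ V v, V w, b v w = 0, b v v < 0 & 0 < b w w]
  end.

Record contact_structure (R : realType) (M : manifold3 R) (s : geometry) :=
  ContactStructure {
  dplane : M -> set (tvec M);
  dmetric : M -> tvec M -> tvec M -> R;
  dpos : M -> tvec M -> tvec M -> Prop;
  dplane_distribution : distribution2 dplane;
  dplane_contact : contact dplane;
  dpos_orientation : orientation dplane dpos;
  dmetric_symbilinear : forall p, symbilinear_on (dplane p) (dmetric p);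
  dmetric_signature : forall p, has_signature s (dplane p) (dmetric p);
  dmetric_smooth : forall U X Y, open U -> section_of dplane U X -> section_of dplane U Y ->
    smooth_on U (fun p => dmetric p (X p) (Y p)) }.

Section Contact.
Context {R : realType} {M : manifold3 R} {s : geometry}.
Variable S : contact_structure M s.

Definition onframe (U : set M) (X1 X2 : vfield M) : Prop :=
  frame_of (dplane S) U X1 X2 /\
  (forall p, U p ->
   [/\ dpos S p (X1 p) (X2 p),
       dmetric S p (X1 p) (X2 p) = 0,
       dmetric S p (X2 p) (X2 p) = 1
     & dmetric S p (X1 p) (X1 p) =
         match s with SubRiemannian => 1 | SubLorentzian => -1 end]).

Definition reeb (X0 : vfield M) : Prop :=
  smooth_vfield setT X0 /\
  (forall U X1 X2, open U -> onframe U X1 X2 -> forall p, U p ->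
   [/\ dplane S p (lie X0 X1 p), dplane S p (lie X0 X2 p)
     & dplane S p (lie X1 X2 p - X0 p)]).

(* The structural functions: [cij_k] is the component of [X_i, X_j] on X_k. *)
Record structural := Structural {
  c01_1 : M -> R; c01_2 : M -> R;
  c02_1 : M -> R; c02_2 : M -> R;
  c12_1 : M -> R; c12_2 : M -> R }.

Definition is_structural (U : set M) (X0 X1 X2 : vfield M) (c : structural) :
    Prop :=
  forall p, U p ->
  [/\ lie X0 X1 p = c01_1 c p *: X1 p + c01_2 c p *: X2 p,
      lie X0 X2 p = c02_1 c p *: X1 p + c02_2 c p *: X2 p
    & lie X1 X2 p = c12_1 c p *: X1 p + c12_2 c p *: X2 p + X0 p].

Definition kappa_expr (X1 X2 : vfield M) (c : structural) (p : M) : R :=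
  match s with
  | SubRiemannian =>
      app X1 (c12_2 c) p - app X2 (c12_1 c) p
      - c12_1 c p ^+ 2 - c12_2 c p ^+ 2 + 1 / 2 * (c01_2 c p - c02_1 c p)
  | SubLorentzian =>
      app X1 (c12_2 c) p + app X2 (c12_1 c) p
      + c12_1 c p ^+ 2 - c12_2 c p ^+ 2 + 1 / 2 * (c01_2 c p + c02_1 c p)
  end.

Definition is_kappa (X0 : vfield M) (kappa : M -> R) : Prop :=
  forall U X1 X2 c, open U -> onframe U X1 X2 -> is_structural U X0 X1 X2 c ->
  forall p, U p -> kappa p = kappa_expr X1 X2 c p.

Definition hform (X0 X Y : vfield M) (p : M) : R :=
  1 / 2 * (app X0 (fun q => dmetric S q (X q) (Y q)) p
           - dmetric S p (lie X0 X p) (Y p) - dmetric S p (X p) (lie X0 Y p)).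

Definition h_zero (X0 : vfield M) : Prop :=
  forall U X Y, open U -> section_of (dplane S) U X -> section_of (dplane S) U Y ->
  forall p, U p -> hform X0 X Y p = 0.

Definition is_alpha (X0 : vfield M) (alpha : M -> tvec M -> R) : Prop :=
  [/\ oneform alpha, forall p v, dplane S p v -> alpha p v = 0
    & forall p, alpha p (X0 p) = 1].

Definition is_Gc (X0 : vfield M) (c : R) (G : M -> tvec M -> tvec M -> R) :
    Prop :=
  [/\ pseudo_metric G,
      forall p v w, dplane S p v -> dplane S p w -> G p v w = dmetric S p v w,
      forall p, G p (X0 p) (X0 p) = c
    & forall p v, dplane S p v -> G p (X0 p) v = 0].

End Contact.

(* Main.v *)
(* Near every point there is an oriented orthonormal frame (E1, E2) of D; write
   E0 for the Reeb field and s = 1 or -1 for g(E1, E1).  The condition h = 0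
   reduces the structure equations to
     [E0, E1] = a E2,  [E0, E2] = - s a E1,  [E1, E2] = b1 E1 + b2 E2 + E0,
   and kappa = E1(b2) - s E2(b1) - s b1^2 - b2^2 + a.  The Christoffel symbols of
   the Weyl connection are then explicit in a, b1, b2, and so is its curvature.
   The Jacobi identity for (E0, E1, E2) cancels every off-diagonal term of the
   symmetric Ricci form, leaving
     Ric_sym(y, z) = s c / 2 * (c y0 z0)
                     + (kappa - c / 2 - s c eps^2) * (y1 z1 + s y2 z2),
   which is proportional to G = c y0 z0 + s y1 z1 + y2 z2 exactly when
   kappa = c (1 + s eps^2).  The difference of two local Weyl connections is symmetric
   in its arguments and G-antisymmetric in the last two slots, hence zero, so the
   local ones glue to a global one. *)
Require Import Defs.
From HB Require Import structures.
From mathcomp Require Import all_boot all_order all_algebra.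
From mathcomp Require Import all_classical all_reals all_analysis.
From mathcomp Require Import ring lra.

Set Implicit Arguments.
Unset Strict Implicit.
Unset Printing Implicit Defensive.

Import Order.TTheory GRing.Theory Num.Theory.
Import numFieldNormedType.Exports.

Local Open Scope classical_set_scope.
Local Open Scope ring_scope.

(** The form of the definitions shapes the proof. A tangent vector is a functional on all functions,
    with value 0 on those not smooth at the point, and [curvature], [trace] and [scalar_curvature]
    pick by [xget] a value computed from arbitrary extensions or bases. Each must therefore be shown
    independent of these choices: the curvature by a formula from which the derivatives of the
    extensions have cancelled, the trace by conjugation of matrices, the scalar curvature by the
    symmetry of the Gram matrix. Calculus is done on germs ([smooth_at], [vsmooth]), and the Weyl
    conditions are restated at a point ([weyl_at]), because uniqueness has to compare a global
    connection with a formula that is meaningful only on the domain of one frame. Second derivatives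
    in a chart are never commuted; the structure equations serve as commutation rules instead. Since
    [kappa] is constant, the Einstein-Weyl condition is the same numerical equation at every point:
    one point gives necessity, and sufficiency is checked point by point. *)

Lemma near_eq_differentiable (R : numFieldType) (V W : normedModType R)
    (f g : V -> W) (x : V) :
  (\near x, f x = g x) -> differentiable f x -> differentiable g x.
Proof.
move=> fg /diff_locallyP[cf ef].
have fx : f x = g x by exact: nbhs_singleton fg.
have eg : g \o shift x = cst (g x) + 'd f x +o_ 0 id.
  apply/eqaddoP => e e0; move/eqaddoP: ef => /(_ e e0) H.
  have sfg : \forall h \near (0 : V), f (h + x) = g (h + x).
    by have := fg; rewrite (near_shift 0) subr0.
  by apply: filterS2 sfg H => h /= sfg; rewrite !fctE /= -fx -sfg.
apply/diff_locallyP; have -> : 'd g x = 'd f x :> (V -> W) by exact: diff_unique.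
by split.
Qed.

(** * Calculus of [Cn] functions *)

Section EuclideanCalculus.
Context {R : realType}.
Implicit Types (A B : set 'rV[R]_3) (f g : 'rV[R]_3 -> R^o) (n : nat).

(** The derivatives in [Cn] are those of a function on the whole space, so the set only says where
    conditions are tested. Singletons turn smoothness into a property of germs. *)
Lemma Cn_point n A f : Cn n A f <-> forall x, A x -> Cn n [set x] f.
Proof.
elim: n f => [|n IH] f /=; first by split=> [h x Ax _ ->|h x Ax]; [exact: h|exact: (h x)].
split=> [[h1 h2] x Ax|h].
  split=> [_ ->|v]; first exact: h1.
  by move/IH: (h2 v); exact.
split=> [x Ax|v]; first by apply: (h x Ax).1.
by apply/IH => x Ax; apply: (h x Ax).2.
Qed.

Lemma Cn_sub n A B f : B `<=` A -> Cn n A f -> Cn n B f.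
Proof. by move=> BA /Cn_point h; apply/Cn_point => x /BA; exact: h. Qed.

Lemma Cn_near n x f g : (\near x, f x = g x) -> Cn n [set x] f -> Cn n [set x] g.
Proof.
elim: n f g => [|n IH] f g fg /=.
  move=> h _ ->; have fx : f x = g x by exact: nbhs_singleton fg.
  rewrite -[_ _]/(g @ x --> g x) -fx; apply: cvg_trans (h x erefl).
  by move=> P; apply: filterS2 fg => y /= <-.
case=> h1 h2; split=> [_ ->|v].
  exact: near_eq_differentiable (h1 x erefl).
apply: IH (h2 v).
by apply: filterS (near_join fg) => y; exact: near_eq_derive.
Qed.

Lemma Cn_eq n A f g : open A -> (forall x, A x -> f x = g x) ->
  Cn n A f -> Cn n A g.
Proof.
move=> oA fg /Cn_point h; apply/Cn_point => x Ax; apply: Cn_near (h x Ax).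
near=> y; apply: fg; near: y; exact: open_nbhs_nbhs.
Unshelve. all: by end_near. Qed.

Lemma CnW n A f : Cn n.+1 A f -> Cn n A f.
Proof.
elim: n f => [|n IH] f /= [h1 h2].
  by move=> x Ax; apply: differentiable_continuous; exact: h1.
by split=> // v; apply: IH; exact: h2.
Qed.

Lemma Cn_cst n A (a : R) : Cn n A (fun=> a).
Proof.
elim: n a => [|n IH] a /=; first by move=> x _; exact: cst_continuous.
split=> [x _|v]; first exact: differentiable_cst.
have -> : (fun x => 'D_v (fun=> a : R^o) x) = (fun=> 0).
  by apply/funext => x; exact: derive_cst.
exact: IH.
Qed.

Lemma CnD n A f g : open A -> Cn n A f -> Cn n A g ->
  Cn n A (fun x => f x + g x).
Proof.
move=> oA; elim: n f g => [|n IH] f g /=.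
  by move=> hf hg x Ax; apply: continuousD; [exact: hf|exact: hg].
case=> f1 f2 [g1 g2]; split=> [x Ax|v].
  by apply: differentiableD; [exact: f1|exact: g1].
apply: Cn_eq (IH _ _ (f2 v) (g2 v)) => // x Ax.
by rewrite -deriveD//; apply: diff_derivable; [exact: f1|exact: g1].
Qed.

Lemma CnM n A f g : open A -> Cn n A f -> Cn n A g ->
  Cn n A (fun x => f x * g x).
Proof.
move=> oA; elim: n f g => [|n IH] f g.
  by move=> hf hg x Ax; apply: continuousM; [exact: hf|exact: hg].
move=> hf hg; have [f1 f2] := hf; have [g1 g2] := hg; split=> [x Ax|v].
  by apply: differentiableM; [exact: f1|exact: g1].
apply: Cn_eq (CnD oA (IH _ _ (CnW hf) (g2 v)) (IH _ _ (CnW hg) (f2 v))) => // x Ax.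
by rewrite -deriveM//; apply: diff_derivable; [exact: f1|exact: g1].
Qed.

(** The derivative of 1/f is - f' / f^2, which involves 1/f only to the order already known by
    induction. *)
Lemma CnV n A f : open A -> (forall x, A x -> f x != 0) -> Cn n A f ->
  Cn n A (fun x => (f x)^-1).
Proof.
move=> oA f0; elim: n => [|n IH].
  by move=> hf x Ax; apply: continuousV; [exact: f0|exact: hf].
move=> hf; have [f1 f2] := hf; split=> [x Ax|v].
  by apply: differentiableV; [exact: f1|exact: f0].
have h := IH (CnW hf).
apply: Cn_eq (CnM oA (Cn_cst n A (-1)) (CnM oA (CnM oA h h) (f2 v))) => // x Ax.
rewrite deriveV ?f0//; last exact/diff_derivable/f1.
by rewrite -[RHS]/(_ * _) expr2 invfM !mulNr mul1r.
Qed.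

(** Induction again: the derivative f' / (2 sqrt f) contains the square root itself, known one order
    lower, and an inverse handled by [CnV]. *)
Lemma Cn_sqrt n A f : open A -> (forall x, A x -> 0 < f x) -> Cn n A f ->
  Cn n A (fun x => Num.sqrt (f x)).
Proof.
move=> oA f0; elim: n => [|n IH].
  move=> hf x Ax; apply: (@continuous_comp _ _ _ f Num.sqrt); first exact: hf.
  exact: sqrt_continuous.
move=> hf; have [f1 f2] := hf.
have ds x : A x -> differentiable (Num.sqrt : R -> R^o) (f x).
  by move=> Ax; apply/derivable1_diffP; have [] := is_derive1_sqrt (f0 x Ax).
split=> [x Ax|v].
  exact: (@differentiable_comp _ _ _ _ f (Num.sqrt : R -> R^o) _ (f1 x Ax) (ds x Ax)).
have h : Cn n A (fun x => (2 * Num.sqrt (f x))^-1).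
  apply: CnV => //; last by apply: CnM => //; [exact: Cn_cst|exact/IH/CnW].
  by move=> x Ax; rewrite mulf_neq0// gt_eqF// sqrtr_gt0 f0.
apply: Cn_eq (CnM oA h (f2 v)) => // x Ax.
rewrite [in RHS]deriveE; last first.
  exact: (@differentiable_comp _ _ _ _ f (Num.sqrt : R -> R^o) _ (f1 x Ax) (ds x Ax)).
rewrite (@diff_comp _ _ _ _ f (Num.sqrt : R -> R^o) _ (f1 x Ax) (ds x Ax))/=.
rewrite -(deriveE _ (f1 x Ax)) diff1E; last exact: ds.
by rewrite derive1E (derive_sqrt (f0 x Ax)) mulrC.
Qed.

End EuclideanCalculus.

(** * Germs of smooth functions and vector fields *)

Section Germs.
Context {R : realType} (M : manifold3 R).
Implicit Types (U V : set M) (f g : M -> R) (p q : M) (v w : tvec M)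
  (X Y Z : vfield M).

(** The image is cut out of the chart image by the preimage of [U] under [cinv]. As [cinv] is
    continuous only at points of the chart image, openness is proved point by point. *)
Lemma open_chart_image (phi : chart R M) U : open U ->
  open (cmap phi @` (U `&` cdom phi)).
Proof.
move=> oU; have -> : cmap phi @` (U `&` cdom phi) =
    (cmap phi @` cdom phi) `&` (cinv phi @^-1` U).
  apply/seteqP; split=> [_ [q [Uq dq] <-]|_ [[q dq <-]]] /=.
    by split; [exists q|rewrite /= cmapK].
  by rewrite cmapK// => Uq; exists q.
rewrite openE => x [ix Ux]; apply: filterI.
  by have := @cimg_open _ _ phi; rewrite openE; exact.
apply: (@cinv_cont _ _ phi x ix).
exact: open_nbhs_nbhs.
Qed.

Lemma smooth_on_sub U V f : V `<=` U -> smooth_on U f -> smooth_on V f.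
Proof.
move=> VU h phi aphi n; apply: Cn_sub (h phi aphi n).
by apply: image_subset; apply: setSI.
Qed.

Lemma smooth_onP U f : open U ->
  smooth_on U f <-> forall p, U p -> smooth_at p f.
Proof.
move=> oU; split=> [h p Up|h phi aphi n]; first by exists U.
apply/Cn_point => _ [p [Up dp] <-]; have [V [oV Vp /(_ phi aphi n)]] := h p Up.
by apply: Cn_sub => _ ->; exists p.
Qed.

Lemma near_smooth p f : smooth_at p f -> \forall q \near p, smooth_at q f.
Proof.
case=> U [oU Up fU]; apply: filterS (open_nbhs_nbhs (conj oU Up)) => q Uq.
by exists U.
Qed.

Lemma nbhs_openP p (P : M -> Prop) : (\forall q \near p, P q) <->
  exists U, [/\ open U, U p & forall q, U q -> P q].
Proof.
rewrite -[X in X <-> _]/(nbhs p P) nbhsE.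
by split=> [[U [oU Up] UP]|[U [oU Up UP]]]; exists U.
Qed.

Lemma smooth_near_eq p f g : (\forall q \near p, f q = g q) ->
  smooth_at p f -> smooth_at p g.
Proof.
move=> /nbhs_openP[V [oV Vp fg]] [U [oU Up fU]].
exists (U `&` V); split=> //; first exact: openI.
move=> phi aphi n; have oI := @open_chart_image phi _ (openI oU oV).
apply: (Cn_eq oI) (Cn_sub _ (fU phi aphi n)).
  by move=> _ [q [[Uq Vq] dq] <-] /=; rewrite cmapK// fg.
by move=> _ [q [[Uq Vq] dq] <-]; exists q.
Qed.

Lemma smooth_at2 p f g (h : M -> R) :
  (forall phi U n, open U -> Cn n (cmap phi @` (U `&` cdom phi)) (f \o cinv phi) ->
    Cn n (cmap phi @` (U `&` cdom phi)) (g \o cinv phi) ->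
    Cn n (cmap phi @` (U `&` cdom phi)) (h \o cinv phi)) ->
  smooth_at p f -> smooth_at p g -> smooth_at p h.
Proof.
move=> H [U [oU Up fU]] [V [oV Vp gV]].
exists (U `&` V); split=> //; first exact: openI.
move=> phi aphi n; apply: H; first exact: openI.
- exact: (@smooth_on_sub U (U `&` V)).
- exact: (@smooth_on_sub V (U `&` V)).
Qed.

Lemma smooth_cst p (a : R) : smooth_at p (fun=> a).
Proof. by exists setT; split=> //; [exact: openT|move=> phi _ n; exact: Cn_cst]. Qed.

Lemma smoothD p f g : smooth_at p f -> smooth_at p g ->
  smooth_at p (fun q => f q + g q).
Proof.
by apply: smooth_at2 => phi U n oU; apply: CnD; exact: open_chart_image.
Qed.

Lemma smoothM p f g : smooth_at p f -> smooth_at p g ->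
  smooth_at p (fun q => f q * g q).
Proof.
by apply: smooth_at2 => phi U n oU; apply: CnM; exact: open_chart_image.
Qed.

Lemma smoothN p f : smooth_at p f -> smooth_at p (fun q => - f q).
Proof.
move=> /(smoothM (smooth_cst p (-1))); apply: smooth_near_eq.
by apply: nearW => q; rewrite mulN1r.
Qed.

Lemma smoothB p f g : smooth_at p f -> smooth_at p g ->
  smooth_at p (fun q => f q - g q).
Proof. by move=> hf /smoothN; exact: smoothD. Qed.

Lemma smooth_continuous p f : smooth_at p f -> {for p, continuous f}.
Proof.
move=> [U [oU Up fU]]; have [phi aphi dp] := atlas_cover p.
have /= cf := fU phi aphi 0%N _ (ex_intro2 _ _ p (conj Up dp) erefl).
have : (f \o cinv phi) (cmap phi q) @[q --> p] --> (f \o cinv phi) (cmap phi p).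
  exact: (cvg_comp _ _ (@cmap_cont _ _ phi p dp) cf).
rewrite /= cmapK// => H; rewrite -[_ _]/(f @ p --> f p).
have nd : nbhs p (cdom phi).
  by apply: open_nbhs_nbhs; split=> //; exact: (@cdom_open _ _ phi).
by move=> P /H; apply: filterS2 nd => q dq /=; rewrite cmapK.
Qed.

Lemma near_gt0 p f : smooth_at p f -> 0 < f p -> \forall q \near p, 0 < f q.
Proof. by move=> /smooth_continuous cf f0; exact: (cvgr_gt (f p) cf). Qed.

Lemma smooth_at1 p f (h : M -> R) :
  (forall phi U n, open U -> Cn n (cmap phi @` (U `&` cdom phi)) (f \o cinv phi) ->
    (forall q, U q -> 0 < f q) ->
    Cn n (cmap phi @` (U `&` cdom phi)) (h \o cinv phi)) ->
  smooth_at p f -> 0 < f p -> smooth_at p h.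
Proof.
move=> H sf /(near_gt0 sf) /nbhs_openP[V [oV Vp f0]].
have [U [oU Up fU]] := sf.
exists (U `&` V); split=> //; first exact: openI.
move=> phi aphi n; apply: H => [||q [_ /f0]//]; first exact: openI.
exact: (@smooth_on_sub U (U `&` V)).
Qed.

Lemma smoothV p f : smooth_at p f -> 0 < f p -> smooth_at p (fun q => (f q)^-1).
Proof.
apply: smooth_at1 => phi U n oU fU f0; apply: CnV => //.
  exact: open_chart_image.
by move=> _ [q [Uq dq] <-]; rewrite /= cmapK// gt_eqF// f0.
Qed.

Lemma smooth_sqrt p f : smooth_at p f -> 0 < f p ->
  smooth_at p (fun q => Num.sqrt (f q)).
Proof.
apply: smooth_at1 => phi U n oU fU f0; apply: Cn_sqrt => //.
  exact: open_chart_image.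
by move=> _ [q [Uq dq] <-]; rewrite /= cmapK// f0.
Qed.

(** * Tangent vectors as derivations of germs *)

Lemma tangent_chart p v : tangent p v -> exists (phi : chart R M) (a : 'rV[R]_3),
  [/\ atlas phi, cdom phi p,
    forall f, smooth_at p f -> v f = 'D_a (f \o cinv phi : _ -> R^o) (cmap phi p)
    & forall f, ~ smooth_at p f -> v f = 0].
Proof.
move=> tv; have [phi aphi dp] := atlas_cover p.
have [a va] := tv phi aphi dp; exists phi, a; split=> // f sf.
  by rewrite va; case: asboolP.
by rewrite va; case: asboolP.
Qed.

Lemma tangent_nsmooth p v f : tangent p v -> ~ smooth_at p f -> v f = 0.
Proof. by move=> /tangent_chart[phi [a [_ _ _ h]]]; exact: h. Qed.

Lemma smooth_differentiable p f (phi : chart R M) : atlas phi -> cdom phi p ->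
  smooth_at p f -> differentiable (f \o cinv phi : _ -> R^o) (cmap phi p).
Proof.
move=> aphi dp [U [oU Up /(_ phi aphi 1%N)[h _]]]; apply: h.
by exists p.
Qed.

(** No smoothness is assumed: if one of two functions with equal germs is not smooth at [p], neither
    is the other, and both values are the default 0. *)
Lemma tangent_near_eq p v f g : tangent p v -> (\forall q \near p, f q = g q) ->
  v f = v g.
Proof.
move=> tv fg; have [phi [a [aphi dp h1 h2]]] := tangent_chart tv.
have gf : \forall q \near p, g q = f q by apply: filterS fg => q ->.
have [sf|nsf] := pselect (smooth_at p f); last first.
  by rewrite !h2// => sg; apply: nsf; exact: smooth_near_eq sg.
rewrite !h1//; last exact: smooth_near_eq sf.
apply: near_eq_derive; move/nbhs_openP: fg => [V [oV Vp fg]].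
have oI := @open_chart_image phi _ oV.
apply: filterS (open_nbhs_nbhs (conj oI (ex_intro2 _ _ p (conj Vp dp) erefl))).
by move=> _ [q [Vq dq] <-] /=; rewrite cmapK// fg.
Qed.

Lemma tangentD p v f g : tangent p v -> smooth_at p f -> smooth_at p g ->
  v (fun q => f q + g q) = v f + v g.
Proof.
move=> tv sf sg; have [phi [a [aphi dp h _]]] := tangent_chart tv.
rewrite !h//; last exact: smoothD.
by rewrite -deriveD//; apply/diff_derivable/smooth_differentiable.
Qed.

Lemma tangentM p v f g : tangent p v -> smooth_at p f -> smooth_at p g ->
  v (fun q => f q * g q) = f p * v g + g p * v f.
Proof.
move=> tv sf sg; have [phi [a [aphi dp h _]]] := tangent_chart tv.
rewrite !h//; last exact: smoothM.
have <- : (f \o cinv phi) (cmap phi p) = f p by rewrite /= cmapK.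
have <- : (g \o cinv phi) (cmap phi p) = g p by rewrite /= cmapK.
rewrite -[RHS]/(_ *: _ + _ *: _).
by rewrite -deriveM//; apply/diff_derivable/smooth_differentiable.
Qed.

Lemma tangent_cst p v (a : R) : tangent p v -> v (fun=> a) = 0.
Proof.
move=> tv; have [phi [b [aphi dp h _]]] := tangent_chart tv.
by rewrite h; [exact: derive_cst|exact: smooth_cst].
Qed.

Lemma tangentN p v f : tangent p v -> smooth_at p f ->
  v (fun q => - f q) = - v f.
Proof.
move=> tv sf; rewrite -mulN1r -[RHS]addr0 -[X in _ + X](mulr0 (f p)).
rewrite -(tangent_cst (-1) tv) -(tangentM tv (smooth_cst p _) sf).
by apply: (tangent_near_eq tv); apply: nearW => q; rewrite mulN1r.
Qed.

Lemma tangentB p v f g : tangent p v -> smooth_at p f -> smooth_at p g ->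
  v (fun q => f q - g q) = v f - v g.
Proof. by move=> tv sf sg; rewrite (tangentD tv sf (smoothN sg)) (tangentN tv sg). Qed.

(** This rests on total differentiability: directional derivatives alone need not be linear in the
    direction. *)
Lemma tangent_lin p v w (a b : R) : tangent p v -> tangent p w ->
  tangent p (a *: v + b *: w).
Proof.
move=> tv tw phi aphi dp; have [x vx] := tv phi aphi dp.
have [y wy] := tw phi aphi dp; exists (a *: x + b *: y) => f.
rewrite -[LHS]/(a *: v f + b *: w f) vx wy; case: asboolP => [sf|_]; last first.
  by rewrite !scaler0 addr0.
have df := smooth_differentiable aphi dp sf.
by rewrite !deriveE// linearD !linearZ.
Qed.

Lemma tangentZ p v (a : R) : tangent p v -> tangent p (a *: v).
Proof.
by move=> tv; rewrite -[X in tangent _ X]addr0 -(scale0r v); exact: tangent_lin.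
Qed.

Lemma tangent_add p v w : tangent p v -> tangent p w -> tangent p (v + w).
Proof.
by move=> tv tw; rewrite -(scale1r v) -(scale1r w); exact: tangent_lin.
Qed.

Lemma tangent_sub p v w : tangent p v -> tangent p w -> tangent p (v - w).
Proof.
by move=> tv tw; rewrite -(scale1r v) -scaleN1r; exact: tangent_lin.
Qed.

Lemma tangent0 p : tangent p 0.
Proof. by move=> phi aphi dp; exists 0 => f; rewrite derive0; case: ifP. Qed.

Lemma tvec_eqP p v w : tangent p v -> tangent p w ->
  (forall f, smooth_at p f -> v f = w f) -> v = w.
Proof.
move=> tv tw h; apply/funext => f.
by have [/h//|nsf] := pselect (smooth_at p f); rewrite !(tangent_nsmooth _ nsf).
Qed.

(** Germ version of [smooth_vfield]; it spares carrying and shrinking a common domain when fields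
    are combined. *)
Definition vsmooth p X := exists U, [/\ open U, U p & smooth_vfield U X].

Lemma vsmooth_tangent p X : vsmooth p X -> tangent p (X p).
Proof. by case=> U [oU Up [h _]]; exact: h. Qed.

Lemma near_vsmooth p X : vsmooth p X -> \forall q \near p, vsmooth q X.
Proof.
case=> U [oU Up XU]; apply: filterS (open_nbhs_nbhs (conj oU Up)) => q Uq.
by exists U.
Qed.

Lemma near_tangent p X : vsmooth p X -> \forall q \near p, tangent q (X q).
Proof. by move=> /near_vsmooth; apply: filterS => q; exact: vsmooth_tangent. Qed.

Lemma smooth_app p X f : vsmooth p X -> smooth_at p f -> smooth_at p (app X f).
Proof.
case=> U [oU Up [_ XU]] [V [oV Vp fV]].
exists (U `&` V); split=> //; first exact: openI.
by apply: XU; [exact: openI|exact: subIsetl|exact: smooth_on_sub fV].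
Qed.

Lemma vsmoothP p X : vsmooth p X <-> (\forall q \near p, tangent q (X q)) /\
  (\forall q \near p, forall f, smooth_at q f -> smooth_at q (app X f)).
Proof.
split=> [h|[/nbhs_openP[U [oU Up h1]] /nbhs_openP[V [oV Vp h2]]]].
  split; first exact: near_tangent.
  by apply: filterS (near_vsmooth h) => q hq f; exact: smooth_app.
exists (U `&` V); split=> //; first exact: openI.
split=> [q [Uq _]|W f oW WUV /(smooth_onP _ oW) fW]; first exact: h1.
by apply/smooth_onP => // q Wq; apply: h2; [exact: (WUV q Wq).2|exact: fW].
Qed.

Lemma smooth_vfieldP U X : open U ->
  smooth_vfield U X <-> forall p, U p -> vsmooth p X.
Proof.
move=> oU; split=> [XU p Up|h]; first by exists U.
split=> [p /h/vsmooth_tangent//|V f oV VU /(smooth_onP _ oV) fV].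
by apply/smooth_onP => // p Vp; apply: smooth_app; [exact/h/VU|exact: fV].
Qed.

Lemma vsmooth_near_eq p X Y : (\forall q \near p, X q = Y q) ->
  vsmooth p X -> vsmooth p Y.
Proof.
move=> XY /vsmoothP[h1 h2]; apply/vsmoothP; split.
  by apply: filterS2 XY h1 => q <-.
apply: filterS2 (near_join XY) h2 => q XYq h2 f /h2.
by apply: smooth_near_eq; apply: filterS XYq => r; rewrite /app => ->.
Qed.

Lemma vsmoothD p X Y : vsmooth p X -> vsmooth p Y ->
  vsmooth p (fun q => X q + Y q).
Proof.
move=> hX hY; apply/vsmoothP; split.
  by apply: filterS2 (near_tangent hX) (near_tangent hY) => q; exact: tangent_add.
apply: filterS2 (near_vsmooth hX) (near_vsmooth hY) => q Xq Yq f sf.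
exact: (smoothD (smooth_app Xq sf) (smooth_app Yq sf)).
Qed.

Lemma vsmoothZ p f X : smooth_at p f -> vsmooth p X ->
  vsmooth p (fun q => f q *: X q).
Proof.
move=> hf hX; apply/vsmoothP; split.
  by apply: filterS (near_tangent hX) => q; exact: tangentZ.
apply: filterS2 (near_smooth hf) (near_vsmooth hX) => q fq Xq g sg.
exact: (smoothM fq (smooth_app Xq sg)).
Qed.

Lemma lieE p X Y f : smooth_at p f ->
  lie X Y p f = X p (app Y f) - Y p (app X f).
Proof. by move=> sf; rewrite /lie; case: asboolP. Qed.

(* Tangency of the bracket is assumed: in an adapted frame it follows from the
   structure equations, which avoids the symmetry of second derivatives. *)
Lemma vsmooth_lie p X Y : vsmooth p X -> vsmooth p Y ->
  (\forall q \near p, tangent q (lie X Y q)) -> vsmooth p (lie X Y).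
Proof.
move=> hX hY ht; apply/vsmoothP; split=> //.
apply: filterS2 (near_vsmooth hX) (near_vsmooth hY) => q Xq Yq f sf.
have := smoothB (smooth_app Xq (smooth_app Yq sf)) (smooth_app Yq (smooth_app Xq sf)).
apply: smooth_near_eq; apply: filterS (near_smooth sf) => r sfr.
by rewrite [RHS]/app lieE.
Qed.

End Germs.

(** * Orthonormal frames of the contact distribution *)

Section Bilinear.
Context {R : realType} (M : manifold3 R).
Implicit Types (V : set (tvec M)) (v w : tvec M).

Lemma tvecD v w f : (v + w) f = v f + w f :> R. Proof. by []. Qed.
Lemma tvecB v w f : (v - w) f = v f - w f :> R. Proof. by []. Qed.
Lemma tvecN v f : (- v) f = - v f :> R. Proof. by []. Qed.
Lemma tvecZ (a : R) v f : (a *: v) f = a * v f :> R. Proof. by []. Qed.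
Lemma tvec0 f : (0 : tvec M) f = 0 :> R. Proof. by []. Qed.
Definition tvecE := (tvecD, tvecB, tvecN, tvecZ, tvec0).

Definition subspace V := V 0 /\
  forall (a b : R) v w, V v -> V w -> V (a *: v + b *: w).

Lemma subspace_tangent p : subspace (@tangent R M p).
Proof. by split; [exact: tangent0|move=> a b v w; exact: tangent_lin]. Qed.

Lemma span_subspace (x1 x2 : tvec M) :
  subspace [set v | exists a b : R, v = a *: x1 + b *: x2].
Proof.
split; first by exists 0, 0; rewrite !scale0r addr0.
move=> a b v w [x [y ->]] [z [t ->]]; exists (a * x + b * z), (a * y + b * t).
by apply/funext => f; rewrite !tvecE; ring.
Qed.

Lemma linear_on2 V l (a b : R) v w : subspace V -> linear_on V l -> V v -> V w ->
  l (a *: v + b *: w) = a * l v + b * l w.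
Proof.
move=> [V0 VL] ll Vv Vw.
have l0 : l 0 = 0.
  have := ll 1 0 0 V0 V0; rewrite scale1r addr0 mul1r => /eqP.
  by rewrite -subr_eq0 opprD addrA subrr sub0r oppr_eq0 => /eqP.
have Vbw : V (b *: w) by have := VL 0 b w w Vw Vw; rewrite scale0r add0r.
rewrite ll//; congr (_ + _).
by have := ll b w 0 Vw V0; rewrite addr0 l0 addr0.
Qed.

Lemma bilinear_on2l V b (x y : R) v w u : subspace V -> symbilinear_on V b ->
  V v -> V w -> V u -> b (x *: v + y *: w) u = x * b v u + y * b w u.
Proof. by move=> sV [_ lin] Vv Vw Vu; apply: (linear_on2 x y sV (lin u Vu)). Qed.

Lemma bilinear_on2r V b (x y : R) v w u : subspace V -> symbilinear_on V b ->
  V v -> V w -> V u -> b u (x *: v + y *: w) = x * b u v + y * b u w.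
Proof.
move=> sV hb Vv Vw Vu; rewrite hb.1//; last exact: sV.2.
by rewrite (bilinear_on2l _ _ sV hb)// !(hb.1 u).
Qed.

Lemma bilinear_on22 V b (x y z t : R) v w : subspace V -> symbilinear_on V b ->
  V v -> V w -> b (x *: v + y *: w) (z *: v + t *: w) =
  x * z * b v v + (x * t + y * z) * b v w + y * t * b w w.
Proof.
move=> sV hb Vv Vw; rewrite (bilinear_on2l _ _ sV hb)//; last exact: sV.2.
by rewrite !(bilinear_on2r _ _ sV hb)// (hb.1 w v)//; ring.
Qed.

End Bilinear.

Definition sgn (R : realType) (s : geometry) : R :=
  match s with SubRiemannian => 1 | SubLorentzian => -1 end.

Lemma sgn_sqr (R : realType) s : sgn R s * sgn R s = 1.
Proof. by case: s => /=; ring. Qed.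

Section Frames.
Context {R : realType} {M : manifold3 R} {s : geometry}.
Variable S : contact_structure M s.
Notation sg := (sgn R s).
Implicit Types (U : set M) (p q : M) (v w : tvec M) (X Y Z : vfield M).

Lemma frame_free U X1 X2 p : frame_of (dplane S) U X1 X2 -> U p ->
  free2 (X1 p) (X2 p) /\
  dplane S p = [set v : tvec M | exists a b : R, v = a *: X1 p + b *: X2 p].
Proof. by case=> _ _; apply. Qed.

Lemma frame_subspace U X1 X2 p : frame_of (dplane S) U X1 X2 -> U p ->
  subspace (dplane S p).
Proof. by case=> _ _ h Up; have [_ ->] := h p Up; exact: span_subspace. Qed.

Lemma subspace_dplane p : subspace (dplane S p).
Proof.
have [U [X1 [X2 [_ Up h]]]] := dplane_distribution S p.
exact: frame_subspace h Up.
Qed.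

Lemma dplane_tangent p v : dplane S p v -> tangent p v.
Proof.
have [U [X1 [X2 [_ Up [[t1 _] [t2 _] h]]]]] := dplane_distribution S p.
have [_ ->] := h p Up; case=> a [b ->].
by apply: tangent_lin; [exact: t1|exact: t2].
Qed.

Lemma frame_mem U X1 X2 p : frame_of (dplane S) U X1 X2 -> U p ->
  dplane S p (X1 p) /\ dplane S p (X2 p).
Proof.
case=> _ _ h Up; have [_ ->] := h p Up; split.
  by exists 1, 0; rewrite scale1r scale0r addr0.
by exists 0, 1; rewrite scale1r scale0r add0r.
Qed.

Lemma frame_change U V X1 X2 (a b c d : M -> R) : open U -> open V -> V `<=` U ->
  frame_of (dplane S) U X1 X2 ->
  (forall q, V q -> [/\ smooth_at q a, smooth_at q b, smooth_at q c & smooth_at q d]) ->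
  (forall q, V q -> a q * d q - b q * c q != 0) ->
  frame_of (dplane S) V (fun q => a q *: X1 q + b q *: X2 q)
                        (fun q => c q *: X1 q + d q *: X2 q).
Proof.
move=> oU oV VU [/(smooth_vfieldP _ oU) s1 /(smooth_vfieldP _ oU) s2 h] sm det; split.
- apply/(smooth_vfieldP _ oV) => q Vq; have [sa sb _ _] := sm q Vq.
  by apply: vsmoothD; apply: vsmoothZ => //; [exact/s1/VU|exact/s2/VU].
- apply/(smooth_vfieldP _ oV) => q Vq; have [_ _ sc sd] := sm q Vq.
  by apply: vsmoothD; apply: vsmoothZ => //; [exact/s1/VU|exact/s2/VU].
move=> q Vq; have [free ->] := h q (VU q Vq); have D0 := det q Vq.
have lin x y : x *: (a q *: X1 q + b q *: X2 q) + y *: (c q *: X1 q + d q *: X2 q)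
   = (x * a q + y * c q) *: X1 q + (x * b q + y * d q) *: X2 q.
  by apply/funext => f; rewrite !tvecE; ring.
split=> [x y|].
  rewrite lin// => /free[e1 e2].
  have ex : x * (a q * d q - b q * c q) =
      d q * (x * a q + y * c q) - c q * (x * b q + y * d q) by ring.
  have ey : y * (a q * d q - b q * c q) =
      a q * (x * b q + y * d q) - b q * (x * a q + y * c q) by ring.
  by split; apply: (mulIf D0); rewrite ?ex ?ey e1 e2; ring.
apply/seteqP; split=> [_ [x [y ->]]|_ [x [y ->]]].
  exists ((x * d q - y * c q) / (a q * d q - b q * c q)),
         ((y * a q - x * b q) / (a q * d q - b q * c q)).
  by rewrite lin//; congr (_ *: _ + _ *: _); field.
by rewrite lin//; eexists; eexists.
Qed.

Lemma dmetric_smooth_frame U X1 X2 p : open U -> frame_of (dplane S) U X1 X2 ->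
  U p -> [/\ smooth_at p (fun q => dmetric S q (X1 q) (X1 q)),
             smooth_at p (fun q => dmetric S q (X1 q) (X2 q))
           & smooth_at p (fun q => dmetric S q (X2 q) (X2 q))].
Proof.
move=> oU fr Up; have [s1 s2 _] := fr.
have c1 : section_of (dplane S) U X1 by split=> // q Uq; exact: (frame_mem fr Uq).1.
have c2 : section_of (dplane S) U X2 by split=> // q Uq; exact: (frame_mem fr Uq).2.
by split; exists U; split=> //; exact: dmetric_smooth.
Qed.

(* Gram-Schmidt in a positive definite plane, and a signature basis otherwise:
   in both cases some basis diagonalises the metric with signs [(sg, 1)]. *)
Lemma orthogonal_basis (s' : geometry) (D : set (tvec M)) (g : tvec M -> tvec M -> R)
    (x1 x2 : tvec M) : symbilinear_on D g -> has_signature s' D g -> free2 x1 x2 ->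
  D = [set v | exists a b : R, v = a *: x1 + b *: x2] ->
  exists a b c d : R,
  [/\ 0 < a * d - b * c,
    g (a *: x1 + b *: x2) (c *: x1 + d *: x2) = 0,
    0 < sgn R s' * g (a *: x1 + b *: x2) (a *: x1 + b *: x2)
  & 0 < g (c *: x1 + d *: x2) (c *: x1 + d *: x2)].
Proof.
move=> sb sig free Dp; have sD := span_subspace x1 x2; rewrite -Dp in sD.
have D1 : D x1 by rewrite Dp; exists 1, 0; rewrite scale1r scale0r addr0.
have D2 : D x2 by rewrite Dp; exists 0, 1; rewrite scale1r scale0r add0r.
have E x y z t := bilinear_on22 x y z t sD sb D1 D2.
case: s' sig => /=.
  move=> pos; have g1 : 0 < g x1 x1.
    apply: pos => // X10; have [] := free 1 0.
      by rewrite X10 scaler0 scale0r addr0.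
    by move/eqP; rewrite oner_eq0.
  exists 1, 0, (- g x1 x2 / g x1 x1), 1.
  have g10 := lt0r_neq0 g1; split.
  - by rewrite mul0r subr0 mulr1 ltr01.
  - by rewrite E; field.
  - by rewrite E (_ : _ * _ = g x1 x1)//; ring.
  apply: pos; first exact: sD.2.
  by move/free=> [_ /eqP]; rewrite oner_eq0.
move=> [v [w [Dv Dw vw vv ww]]].
move: Dv Dw vw vv ww; rewrite Dp => -[a [b ->]] [c [d ->]] vw vv ww.
have D0 : a * d - b * c != 0.
  apply/eqP => D0.
  (* A change of basis multiplies the Gram determinant by the square of its own determinant. With
     g(v, w) = 0 the new Gram determinant is g(v, v) g(w, w), which is nonzero. *)
  suff : g (a *: x1 + b *: x2) (a *: x1 + b *: x2) *
         g (c *: x1 + d *: x2) (c *: x1 + d *: x2) = 0.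
    by move/eqP; rewrite mulf_eq0 (lt_eqF vv) (gt_eqF ww).
  rewrite -[LHS]subr0 -[X in _ - X](mulr0 0) -[X in _ - X * _]vw -[X in _ - _ * X]vw.
  rewrite !E.
  transitivity ((a * d - b * c) ^+ 2 * (g x1 x1 *
     g x2 x2 - g x1 x2 ^+ 2)); first by ring.
  by rewrite D0 expr0n mul0r.
(* A wrongly oriented pair is repaired by changing the sign of the second vector, which alters
   neither orthogonality nor the norms. *)
have [D1' | ] := ltrP 0 (a * d - b * c).
  by exists a, b, c, d; split=> //; rewrite mulN1r oppr_gt0.
rewrite le_eqVlt (negbTE D0) /= => Dn.
have Nw : (- c) *: x1 + (- d) *: x2 = -1 *: (c *: x1 + d *: x2) + 0 *: x1.
  by apply/funext => f; rewrite !tvecE; ring.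
have Dw : D (c *: x1 + d *: x2) by exact: sD.2.
have Dv : D (a *: x1 + b *: x2) by exact: sD.2.
exists a, b, (- c), (- d); split.
- by move: Dn; rewrite -oppr_gt0 (_ : - (a * d - b * c) = a * - d - b * - c)//; ring.
- by rewrite Nw (bilinear_on2r _ _ sD sb)// vw mulr0 mul0r addr0.
- by rewrite mulN1r oppr_gt0.
by rewrite Nw (bilinear_on22 _ _ _ _ sD sb)//
  (_ : _ + _ = g (c *: x1 + d *: x2) (c *: x1 + d *: x2))//; ring.
Qed.

(** Gram-Schmidt near [p], started from the combinations with constant coefficients that diagonalise
    the metric at [p]. The strict inequalities required for the square roots hold at [p], hence
    nearby. *)
Lemma onframe_exists p : exists U X1 X2, [/\ open U, U p & onframe S U X1 X2].
Proof.
have [_ posE /(_ p)[U [X1 [X2 [oU Up fr pos]]]]] := dpos_orientation S.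
have [a [b [c [d [det vw vv ww]]]]] := orthogonal_basis (dmetric_symbilinear S p)
  (dmetric_signature S p) (frame_free fr Up).1 (frame_free fr Up).2.
pose g11 q := dmetric S q (X1 q) (X1 q).
pose g12 q := dmetric S q (X1 q) (X2 q).
pose g22 q := dmetric S q (X2 q) (X2 q).
have E q x y z t : U q -> dmetric S q (x *: X1 q + y *: X2 q) (z *: X1 q + t *: X2 q)
    = x * z * g11 q + (x * t + y * z) * g12 q + y * t * g22 q.
  move=> Uq; have [D1 D2] := frame_mem fr Uq.
  exact: bilinear_on22 (frame_subspace fr Uq) (dmetric_symbilinear S q) D1 D2.
have [s11 s12 s22] := dmetric_smooth_frame oU fr Up.
(* Put v = a X1 + b X2 and w = c X1 + d X2. Then [n1] is sg g(v, v), [m] is g(v, w) / g(v, v), and w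
   - m v has coefficients [c'], [d'] and squared norm [n2]. *)
pose n1 q := sg * (a * a * g11 q + (a * b + b * a) * g12 q + b * b * g22 q).
pose m q := sg * (a * c * g11 q + (a * d + b * c) * g12 q + b * d * g22 q) * (n1 q)^-1.
pose c' q := c - m q * a.
pose d' q := d - m q * b.
pose n2 q := c' q * c' q * g11 q + (c' q * d' q + d' q * c' q) * g12 q + d' q * d' q * g22 q.
have sc x : smooth_at p (fun=> x : R) := smooth_cst p x.
have lin3 x y z : smooth_at p x -> smooth_at p y -> smooth_at p z ->
    smooth_at p (fun q => x q * g11 q + y q * g12 q + z q * g22 q).
  by move=> sx sy sz; do 2?apply: smoothD; exact: smoothM.
have sn1 : smooth_at p n1 by apply: smoothM => //; exact: lin3.
have n1p : 0 < n1 p by move: vv; rewrite E.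
have sm : smooth_at p m.
  by apply: smoothM; [apply: smoothM => //; exact: lin3|exact: smoothV].
have sc' : smooth_at p c' by apply: smoothB => //; exact: smoothM.
have sd' : smooth_at p d' by apply: smoothB => //; exact: smoothM.
have sn2 : smooth_at p n2 by apply: lin3; do ?apply: smoothD; exact: smoothM.
(* At [p] the pair is already orthogonal, so [m] vanishes there and [n2 p] is the squared norm of
   w. *)
have n2p : 0 < n2 p.
  have m0 : m p = 0 by rewrite /m -(E p a b c d Up) vw mulr0 mul0r.
  by rewrite /n2 /c' /d' m0 !mul0r !subr0; move: ww; rewrite E.
pose r1 q := (Num.sqrt (n1 q))^-1.
pose r2 q := (Num.sqrt (n2 q))^-1.
have sr1 : smooth_at p r1 by apply: smoothV; [exact: smooth_sqrt|rewrite sqrtr_gt0].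
have sr2 : smooth_at p r2 by apply: smoothV; [exact: smooth_sqrt|rewrite sqrtr_gt0].
have nU : \forall q \near p, U q by apply: open_nbhs_nbhs.
have nV : \forall q \near p, [/\ U q, [/\ smooth_at q r1, smooth_at q r2,
    smooth_at q c' & smooth_at q d'], 0 < n1 q & 0 < n2 q].
  near=> q; split; first by near: q.
  - by split; near: q; exact: near_smooth.
  - by near: q; exact: near_gt0.
  by near: q; exact: near_gt0.
have [V [oV Vp HV]] := (nbhs_openP _ _).1 nV.
have VU : V `<=` U by move=> q /HV[].
have r1p q : V q -> 0 < r1 q by move=> /HV[_ _ h _]; rewrite invr_gt0 sqrtr_gt0.
have r2p q : V q -> 0 < r2 q by move=> /HV[_ _ _ h]; rewrite invr_gt0 sqrtr_gt0.
(* Subtracting a multiple of v from w keeps the determinant, so only the positive factors [r1] and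
   [r2] enter and the orientation is preserved. *)
have detE q : (r1 q * a) * (r2 q * d' q) - (r1 q * b) * (r2 q * c' q)
  = r1 q * r2 q * (a * d - b * c) by rewrite /d' /c'; ring.
have detp q : V q -> 0 < (r1 q * a) * (r2 q * d' q) - (r1 q * b) * (r2 q * c' q).
  by move=> Vq; rewrite detE; do 2?apply: mulr_gt0 => //; [exact: r1p|exact: r2p].
have frV := @frame_change U V X1 X2 (fun q => r1 q * a) (fun q => r1 q * b)
  (fun q => r2 q * c' q) (fun q => r2 q * d' q) oU oV VU fr.
exists V, (fun q => (r1 q * a) *: X1 q + (r1 q * b) *: X2 q),
  (fun q => (r2 q * c' q) *: X1 q + (r2 q * d' q) *: X2 q); split=> //; split.
  apply: frV => q Vq; last by rewrite gt_eqF// detp.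
  have [_ [h1 h2 h3 h4] _ _] := HV q Vq.
  by split; apply: smoothM => //; exact: smooth_cst.
move=> q Vq; have [Uq _ n1q n2q] := HV q Vq.
have r1n : r1 q * r1 q * n1 q = 1.
  by rewrite -invfM -expr2 sqr_sqrtr ?ltW// mulVf// gt_eqF.
have r2n : r2 q * r2 q * n2 q = 1.
  by rewrite -invfM -expr2 sqr_sqrtr ?ltW// mulVf// gt_eqF.
have ss := sgn_sqr R s.
split.
- by apply/(posE q _ _ (pos q Uq)); [rewrite gt_eqF// detp|exact: detp].
- rewrite E//.
  pose A := a * c * g11 q + (a * d + b * c) * g12 q + b * d * g22 q.
  pose N := a * a * g11 q + (a * b + b * a) * g12 q + b * b * g22 q.
  have mn : m q * n1 q = sg * A by rewrite /m -mulrA mulVf ?mulr1// gt_eqF.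
  transitivity (r1 q * r2 q * (A - m q * N)); first by rewrite /A /N /c' /d'; ring.
  have -> : A = sg * (m q * n1 q) by rewrite mn mulrA ss mul1r.
  have -> : n1 q = sg * N by [].
  transitivity (r1 q * r2 q * m q * N * (sg * sg - 1)); first by ring.
  by rewrite ss subrr mulr0.
- by rewrite E// -r2n /n2; ring.
rewrite E// -[RHS]/sg -[RHS]mulr1 -r1n /n1.
transitivity ((sg * sg) * (r1 q * a * (r1 q * a) * g11 q +
  (r1 q * a * (r1 q * b) + r1 q * b * (r1 q * a)) * g12 q +
  r1 q * b * (r1 q * b) * g22 q)); first by rewrite ss mul1r.
by ring.
Unshelve. all: by end_near. Qed.

End Frames.

(** * Derivations and brackets *)

Section DerivationValue.
Context {R : realType} {M : manifold3 R}.
Implicit Types (f g : M -> R) (p : M) (v : tvec M) (X Y Z : vfield M).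

(** Smoothness and the value of the derivative travel together, so that one pass of the Leibniz
    rules over an expression yields both. *)
Definition dval p v f (d : R) := smooth_at p f /\ v f = d.

Lemma dval_app p v f : smooth_at p f -> dval p v f (v f).
Proof. by split. Qed.

Lemma dval_cst p v (x : R) : tangent p v -> dval p v (fun=> x) 0.
Proof. by move=> tv; split; [exact: smooth_cst|exact: tangent_cst tv]. Qed.

Lemma dvalD p v f g d e : tangent p v -> dval p v f d -> dval p v g e ->
  dval p v (fun q => f q + g q) (d + e).
Proof. by move=> tv [sf <-] [sg <-]; split; [exact: smoothD|exact: tangentD tv sf sg]. Qed.

Lemma dvalN p v f d : tangent p v -> dval p v f d ->
  dval p v (fun q => - f q) (- d).
Proof. by move=> tv [sf <-]; split; [exact: smoothN|exact: tangentN tv sf]. Qed.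

Lemma dvalM p v f g d e : tangent p v -> dval p v f d -> dval p v g e ->
  dval p v (fun q => f q * g q) (f p * e + g p * d).
Proof. by move=> tv [sf <-] [sg <-]; split; [exact: smoothM|exact: tangentM tv sf sg]. Qed.

Lemma dval_eq p v f d e : dval p v f d -> d = e -> dval p v f e.
Proof. by move=> h <-. Qed.

Lemma dval_near_eq p v f g d : tangent p v -> (\forall q \near p, f q = g q) ->
  dval p v f d -> dval p v g d.
Proof.
move=> tv fg [sf <-]; split; first exact: smooth_near_eq sf.
by symmetry; exact: tangent_near_eq tv fg.
Qed.

(** Each double bracket contributes four third-order terms, and the twelve cancel in pairs. The
    inner brackets enter through fields with the same germ, so that their expansions in a frame can
    be used directly. *)
Lemma lie_jacobi p X Y Z (A B C : vfield M) :
  vsmooth p X -> vsmooth p Y -> vsmooth p Z ->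
  (\forall q \near p, A q = lie Y Z q) -> (\forall q \near p, B q = lie Z X q) ->
  (\forall q \near p, C q = lie X Y q) ->
  forall f, smooth_at p f -> lie X A p f + lie Y B p f + lie Z C p f = 0.
Proof.
move=> sX sY sZ.
have key (X' Y' Z' A' : vfield M) f : vsmooth p X' -> vsmooth p Y' -> vsmooth p Z' ->
    (\forall q \near p, A' q = lie Y' Z' q) -> smooth_at p f ->
    lie X' A' p f = X' p (app Y' (app Z' f)) - X' p (app Z' (app Y' f))
       - (Y' p (app Z' (app X' f)) - Z' p (app Y' (app X' f))).
  move=> sX' sY' sZ' eA sf; rewrite lieE//; congr (_ - _); last first.
    by rewrite (nbhs_singleton eA) lieE//; exact: smooth_app.
  rewrite -(tangentB (vsmooth_tangent sX')); try by do 2?apply: smooth_app.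
  apply: (tangent_near_eq (vsmooth_tangent sX')).
  apply: filterS2 eA (near_smooth sf) => q eA sfq.
  by rewrite {1}/app eA lieE.
move=> eA eB eC f sf.
by rewrite (key X Y Z A)// (key Y Z X B)// (key Z X Y C)//; ring.
Qed.

End DerivationValue.

Ltac dval_auto tv := repeat first [ apply: (dvalD tv) | apply: (dvalM tv)
  | apply: (dvalN tv) | apply: (dval_cst _ tv) ].

Section Span.
Context {R : realType} {M : manifold3 R}.
Implicit Types (p : M) (v w : tvec M).

(* In a chart [e] becomes a matrix, whose kernel is trivial by independence. *)
Lemma tangent_basis3 p (e : 'I_3 -> tvec M) : (forall i, tangent p (e i)) ->
  (forall a : 'I_3 -> R, \sum_i a i *: e i = 0 -> forall i, a i = 0) ->
  basis3 p e.
Proof.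
move=> te free; split=> // v tv.
have [phi aphi dp] := atlas_cover p.
pose ch (w : tvec M) (x : 'rV[R]_3) := forall f, w f =
  if `[< smooth_at p f >] then 'D_x (f \o cinv phi : _ -> R^o) (cmap phi p) else 0.
have ch_ex w : tangent p w -> exists x, ch w x by move=> tw; exact: tw phi aphi dp.
have /choice[x xe] : forall i, exists x, ch (e i) x by move=> i; exact: ch_ex.
have [y ve] := ch_ex v tv.
have ch_sum (u : 'I_3 -> R) : ch (\sum_i u i *: e i) (\sum_i u i *: x i).
  move=> f; rewrite (_ : (\sum_i u i *: e i) f = \sum_i u i *: (e i f)); last first.
    by rewrite !big_ord_recl !big_ord0.
  case: asboolP => sf; last first.
    by apply: big1 => i _; rewrite xe; case: asboolP => // _; rewrite scaler0.
  have df := smooth_differentiable aphi dp sf.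
  rewrite deriveE// linear_sum; apply: eq_bigr => i _.
  by rewrite linearZ xe; case: asboolP => // _; rewrite deriveE.
have ch_inj w1 w2 z : ch w1 z -> ch w2 z -> w1 = w2.
  by move=> h1 h2; apply/funext => f; rewrite h1 h2.
pose A : 'M[R]_3 := \matrix_(i, j) x i 0 j.
have mulA (u : 'rV[R]_3) : u *m A = \sum_i u 0 i *: x i.
  apply/rowP => j; rewrite !mxE summxE; apply: eq_bigr => i _.
  by rewrite !mxE.
have uA : A \in unitmx.
  rewrite -row_free_unit -kermx_eq0; apply/eqP/row_matrixP => i.
  rewrite row0; set u := row i _.
  have uA0 : u *m A = 0 by apply/sub_kermxP; exact: row_sub.
  have /free u0 : \sum_i u 0 i *: e i = 0.
    apply: (ch_inj _ _ (\sum_i u 0 i *: x i)) => //.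
    rewrite -mulA uA0 => f; rewrite derive0.
    by case: ifP.
  by apply/rowP => j; rewrite u0 mxE.
exists (fun i => (y *m invmx A) 0 i); apply: (ch_inj _ _ y) => //.
by rewrite -[y in ch _ y](mulmxKV uA) mulA.
Qed.

Definition tri {T : Type} (x y z : T) (i : 'I_3) : T :=
  match val i with 0%N => x | 1%N => y | _ => z end.

Lemma sum3E (V : nmodType) (F : 'I_3 -> V) :
  \sum_i F i = F ord0 + F (lift ord0 ord0) + F (lift ord0 (lift ord0 ord0)).
Proof. by rewrite !big_ord_recl big_ord0 addr0 addrA. Qed.

Lemma forall3 (P : 'I_3 -> Prop) : P ord0 -> P (lift ord0 ord0) ->
  P (lift ord0 (lift ord0 ord0)) -> forall i, P i.
Proof.
move=> h0 h1 h2 [[|[|[|//]]] h].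
- by rewrite (_ : Ordinal h = ord0)//; exact/val_inj.
- by rewrite (_ : Ordinal h = lift ord0 ord0)//; exact/val_inj.
- by rewrite (_ : Ordinal h = lift ord0 (lift ord0 ord0))//; exact/val_inj.
Qed.

End Span.

(** * The Weyl connection in an adapted frame *)

Section Metric.
Context {R : realType} {M : manifold3 R} (G : M -> tvec M -> tvec M -> R).
Hypothesis hG : pseudo_metric G.
Implicit Types (p q : M) (v w : tvec M) (X Y Z : vfield M).

Let symG p : symbilinear_on (tangent p) (G p). Proof. by have [h] := hG. Qed.

Lemma metricC p v w : tangent p v -> tangent p w -> G p v w = G p w v.
Proof. by move=> tv tw; rewrite (symG p).1. Qed.

Lemma metric_linl p v w u (a b : R) : tangent p v -> tangent p w -> tangent p u ->
  G p (a *: v + b *: w) u = a * G p v u + b * G p w u.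
Proof. by move=> *; apply: bilinear_on2l (@subspace_tangent R M p) (symG p) _ _ _. Qed.

Lemma metricZl p v u (a : R) : tangent p v -> tangent p u ->
  G p (a *: v) u = a * G p v u.
Proof.
by move=> tv tu; rewrite -[a *: v]addr0 -(scale0r v) metric_linl// mul0r addr0.
Qed.

Lemma metricDl p v w u : tangent p v -> tangent p w -> tangent p u ->
  G p (v + w) u = G p v u + G p w u.
Proof.
by move=> tv tw tu; rewrite -(scale1r v) -(scale1r w) metric_linl// !scale1r !mul1r.
Qed.

Lemma metricBl p v w u : tangent p v -> tangent p w -> tangent p u ->
  G p (v - w) u = G p v u - G p w u.
Proof.
by move=> tv tw tu; rewrite -(scale1r v) -scaleN1r metric_linl// !scale1r mul1r mulN1r.
Qed.

Lemma metric_nondeg p v : tangent p v ->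
  (forall w, tangent p w -> G p v w = 0) -> v = 0.
Proof. by have [_ h _] := hG; exact: h. Qed.

Lemma smooth_metric p X Y : vsmooth p X -> vsmooth p Y ->
  smooth_at p (fun q => G q (X q) (Y q)).
Proof.
have [_ _ h] := hG.
move=> sX sY; have [U [oU Up HU]] := (nbhs_openP _ _).1
   (filterI (near_vsmooth sX) (near_vsmooth sY)).
exists U; split=> //; apply: h => //; apply/(smooth_vfieldP _ oU) => q /HU[]//.
Qed.

End Metric.

Section Adapted.
Context {R : realType} {M : manifold3 R} (G : M -> tvec M -> tvec M -> R).
Variables (s c e : R) (E0 : vfield M).
Implicit Types (U : set M) (p q : M) (v w : tvec M) (X Y Z : vfield M)
  (f : M -> R).

(* A frame [(E0, E1, E2)], orthogonal for [G] with squared norms [(c, s, 1)],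
   whose brackets have the shape forced by [h = 0]. *)
Record adapted U (E1 E2 : vfield M) (a b1 b2 : M -> R) : Prop := Adapted {
  ad_open : open U;
  ad_E0 : forall q, U q -> vsmooth q E0;
  ad_E1 : forall q, U q -> vsmooth q E1;
  ad_E2 : forall q, U q -> vsmooth q E2;
  ad_a : forall q, U q -> smooth_at q a;
  ad_b1 : forall q, U q -> smooth_at q b1;
  ad_b2 : forall q, U q -> smooth_at q b2;
  ad_00 : forall q, U q -> G q (E0 q) (E0 q) = c;
  ad_11 : forall q, U q -> G q (E1 q) (E1 q) = s;
  ad_22 : forall q, U q -> G q (E2 q) (E2 q) = 1;
  ad_01 : forall q, U q -> G q (E0 q) (E1 q) = 0;
  ad_02 : forall q, U q -> G q (E0 q) (E2 q) = 0;
  ad_12 : forall q, U q -> G q (E1 q) (E2 q) = 0;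
  ad_lie01 : forall q, U q -> lie E0 E1 q = a q *: E2 q;
  ad_lie02 : forall q, U q -> lie E0 E2 q = (- s * a q) *: E1 q;
  ad_lie12 : forall q, U q ->
    lie E1 E2 q = b1 q *: E1 q + b2 q *: E2 q + E0 q }.

Hypothesis hG : pseudo_metric G.
Hypothesis c0 : c != 0.
Hypothesis ss : s * s = 1.

Section Frame.
Variables (U : set M) (E1 E2 : vfield M) (a b1 b2 : M -> R).
Hypothesis ad : adapted U E1 E2 a b1 b2.

(* Coordinates of a tangent vector in the frame [(E0, E1, E2)]. *)
Definition co0 q v := c^-1 * G q v (E0 q).
Definition co1 q v := s * G q v (E1 q).
Definition co2 q v := G q v (E2 q).

Definition comb q (x0 x1 x2 : R) : tvec M :=
  x0 *: E0 q + x1 *: E1 q + x2 *: E2 q.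

Lemma tE0 q : U q -> tangent q (E0 q).
Proof. by move=> Uq; exact: vsmooth_tangent (ad_E0 ad Uq). Qed.
Lemma tE1 q : U q -> tangent q (E1 q).
Proof. by move=> Uq; exact: vsmooth_tangent (ad_E1 ad Uq). Qed.
Lemma tE2 q : U q -> tangent q (E2 q).
Proof. by move=> Uq; exact: vsmooth_tangent (ad_E2 ad Uq). Qed.

Lemma combE q x0 x1 x2 f :
  comb q x0 x1 x2 f = x0 * E0 q f + x1 * E1 q f + x2 * E2 q f.
Proof. by []. Qed.

Lemma tangent_comb q x0 x1 x2 : U q -> tangent q (comb q x0 x1 x2).
Proof.
move=> Uq; apply: tangent_add; last exact/tangentZ/tE2.
by apply: tangent_lin; [exact: tE0|exact: tE1].
Qed.

Lemma metric_comb q x0 x1 x2 w : U q -> tangent q w ->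
  G q (comb q x0 x1 x2) w = x0 * G q (E0 q) w + x1 * G q (E1 q) w + x2 * G q (E2 q) w.
Proof.
move=> Uq tw; have t0 := @tE0 q Uq; have t1 := @tE1 q Uq; have t2 := @tE2 q Uq.
rewrite /comb (metricDl hG (tangent_lin _ _ t0 t1) (tangentZ _ t2) tw).
by rewrite (metric_linl hG)// (metricZl hG).
Qed.

Lemma co_comb q x0 x1 x2 : U q -> [/\ co0 q (comb q x0 x1 x2) = x0,
  co1 q (comb q x0 x1 x2) = x1 & co2 q (comb q x0 x1 x2) = x2].
Proof.
move=> Uq; have t0 := @tE0 q Uq; have t1 := @tE1 q Uq; have t2 := @tE2 q Uq.
rewrite /co0 /co1 /co2 !metric_comb//.
rewrite !(metricC hG _ t0)// (metricC hG t2 t1).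
rewrite (ad_00 ad)// (ad_01 ad)// (ad_02 ad)// (ad_11 ad)// (ad_12 ad)// (ad_22 ad)//.
by split; [field|ring: ss|ring].
Qed.

Lemma comb_inj q x0 x1 x2 y0 y1 y2 : U q -> comb q x0 x1 x2 = comb q y0 y1 y2 ->
  [/\ x0 = y0, x1 = y1 & x2 = y2].
Proof.
move=> Uq exy; have [h0 h1 h2] := co_comb x0 x1 x2 Uq.
have [k0 k1 k2] := co_comb y0 y1 y2 Uq.
by rewrite exy in h0 h1 h2; split; congruence.
Qed.

Lemma sum_tri q (x : 'I_3 -> R) : \sum_i x i *: tri (E0 q) (E1 q) (E2 q) i =
  comb q (x ord0) (x (lift ord0 ord0)) (x (lift ord0 (lift ord0 ord0))).
Proof. by rewrite sum3E. Qed.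

(** Independence comes from orthogonality with nonzero squared norms, spanning from the dimension
    count in [tangent_basis3]. *)
Lemma frame_basis3 q : U q -> basis3 q (tri (E0 q) (E1 q) (E2 q)).
Proof.
move=> Uq; apply: tangent_basis3.
  by apply: forall3; [exact: tE0|exact: tE1|exact: tE2].
move=> x; rewrite sum_tri => h.
have [] := @comb_inj q _ _ _ 0 0 0 Uq (etrans h _).
  by rewrite /comb !scale0r !addr0.
by move=> *; exact: (@forall3 (fun i => x i = 0)).
Qed.

Lemma coK q v : U q -> tangent q v -> v = comb q (co0 q v) (co1 q v) (co2 q v).
Proof.
move=> Uq tv; have [_ _ /(_ v tv)[x]] := frame_basis3 Uq.
rewrite sum_tri; move: (x _) (x _) (x _) => x0 x1 x2 ->.
by have [-> -> ->] := co_comb x2 x1 x0 Uq.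
Qed.

Lemma co0_lin q (x y : R) v w : U q -> tangent q v -> tangent q w ->
  co0 q (x *: v + y *: w) = x * co0 q v + y * co0 q w.
Proof. by move=> Uq tv tw; rewrite /co0 (metric_linl hG)//; [ring|exact: tE0]. Qed.
Lemma co1_lin q (x y : R) v w : U q -> tangent q v -> tangent q w ->
  co1 q (x *: v + y *: w) = x * co1 q v + y * co1 q w.
Proof. by move=> Uq tv tw; rewrite /co1 (metric_linl hG)//; [ring|exact: tE1]. Qed.
Lemma co2_lin q (x y : R) v w : U q -> tangent q v -> tangent q w ->
  co2 q (x *: v + y *: w) = x * co2 q v + y * co2 q w.
Proof. by move=> Uq tv tw; rewrite /co2 (metric_linl hG)//; exact: tE2. Qed.

Lemma smooth_co q Y : U q -> vsmooth q Y ->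
  [/\ smooth_at q (fun r => co0 r (Y r)), smooth_at q (fun r => co1 r (Y r))
    & smooth_at q (fun r => co2 r (Y r))].
Proof.
move=> Uq sY; split.
- by apply: smoothM; [exact: smooth_cst|apply: (smooth_metric hG) => //; exact: (ad_E0 ad Uq)].
- by apply: smoothM; [exact: smooth_cst|apply: (smooth_metric hG) => //; exact: (ad_E1 ad Uq)].
- by apply: (smooth_metric hG) => //; exact: (ad_E2 ad Uq).
Qed.

Lemma near_ad q : U q -> \forall r \near q, U r.
Proof. by move=> Uq; apply: open_nbhs_nbhs; split=> //; exact: (ad_open ad). Qed.

Lemma vsmooth_comb q (x y z : M -> R) : U q -> smooth_at q x -> smooth_at q y ->
  smooth_at q z -> vsmooth q (fun r => comb r (x r) (y r) (z r)).
Proof.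
move=> Uq sx sy sz; apply: vsmoothD; last exact/vsmoothZ/(ad_E2 ad Uq).
by apply: vsmoothD; apply: vsmoothZ => //; [exact: (ad_E0 ad Uq)|exact: (ad_E1 ad Uq)].
Qed.

(** The [w]'s are the components of the wedge of [X] and [Y], which the structure equations
    multiply; the other terms differentiate the coordinates. The result also shows that such
    brackets are tangent. *)
Lemma lie_comb q X Y (x0 x1 x2 y0 y1 y2 : M -> R) : U q ->
  smooth_at q x0 -> smooth_at q x1 -> smooth_at q x2 ->
  smooth_at q y0 -> smooth_at q y1 -> smooth_at q y2 ->
  (\forall r \near q, X r = comb r (x0 r) (x1 r) (x2 r)) ->
  (\forall r \near q, Y r = comb r (y0 r) (y1 r) (y2 r)) ->
  let w01 := x0 q * y1 q - x1 q * y0 q in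
  let w02 := x0 q * y2 q - x2 q * y0 q in
  let w12 := x1 q * y2 q - x2 q * y1 q in
  lie X Y q = comb q (X q y0 - Y q x0 + w12)
                     (X q y1 - Y q x1 - s * a q * w02 + b1 q * w12)
                     (X q y2 - Y q x2 + a q * w01 + b2 q * w12).
Proof.
move=> Uq sx0 sx1 sx2 sy0 sy1 sy2 eX eY w01 w02 w12.
have sX : vsmooth q X.
  apply: vsmooth_near_eq (vsmooth_comb Uq sx0 sx1 sx2).
  by apply: filterS eX => r ->.
have sY : vsmooth q Y.
  apply: vsmooth_near_eq (vsmooth_comb Uq sy0 sy1 sy2).
  by apply: filterS eY => r ->.
have tX := vsmooth_tangent sX; have tY := vsmooth_tangent sY.
have v0 := ad_E0 ad Uq; have v1 := ad_E1 ad Uq; have v2 := ad_E2 ad Uq.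
apply/funext => f; have [sf|nsf] := pselect (smooth_at q f); last first.
  rewrite [RHS](tangent_nsmooth (tangent_comb _ _ _ Uq))// /lie.
  by case: asboolP.
(* Read as commutation rules, the structure equations put the field of larger index outside; the
   second-order terms then cancel. *)
have L01 : E0 q (app E1 f) = E1 q (app E0 f) + a q * E2 q f.
  by rewrite -tvecZ -(ad_lie01 ad)// lieE//; ring.
have L02 : E0 q (app E2 f) = E2 q (app E0 f) - s * a q * E1 q f.
  by rewrite -!mulNr -tvecZ -(ad_lie02 ad)// lieE//; ring.
have L12 : E1 q (app E2 f) = E2 q (app E1 f) + (b1 q * E1 q f + b2 q * E2 q f + E0 q f).
  by rewrite -2!tvecZ -2!tvecD -(ad_lie12 ad)// lieE//; ring.
rewrite lieE//.
have exp (V W : vfield M) z0 z1 z2 : tangent q (V q) ->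
    smooth_at q z0 -> smooth_at q z1 -> smooth_at q z2 ->
    (\forall r \near q, W r = comb r (z0 r) (z1 r) (z2 r)) ->
    V q (app W f) = z0 q * V q (app E0 f) + E0 q f * V q z0
      + (z1 q * V q (app E1 f) + E1 q f * V q z1)
      + (z2 q * V q (app E2 f) + E2 q f * V q z2).
  move=> tV sz0 sz1 sz2 eW.
  have [] : dval q (V q) (app W f) (z0 q * V q (app E0 f) + E0 q f * V q z0
      + (z1 q * V q (app E1 f) + E1 q f * V q z1)
      + (z2 q * V q (app E2 f) + E2 q f * V q z2)) => //.
  apply: (@dval_near_eq _ _ _ _
    (fun r => z0 r * app E0 f r + z1 r * app E1 f r + z2 r * app E2 f r)) => //.
    by apply: filterS eW => r; rewrite /app => ->.
  by dval_auto tV; apply: dval_app => //; exact: smooth_app.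
rewrite (exp X Y y0 y1 y2)// (exp Y X x0 x1 x2)//.
(* Only the occurrences applied to some [app Ei f] are expanded; those that differentiate
   coordinates occur as such in the conclusion. *)
rewrite {1 3 5}(nbhs_singleton eX) {1 3 5}(nbhs_singleton eY) !combE L01 L02 L12.
by rewrite /w01 /w02 /w12; ring.
Qed.

(* Components along [E0], [E1], [E2] of the Christoffel term of [nabla_v y]; [P]
   stands for [(a, b1, b2)] at the point.  They come from Koszul's formula,
   corrected by [- e c alpha(v) y - e c alpha(y) v + e G(v, y) E0]. *)
Definition gam0 (v y : R * R * R) : R :=
  - e * c * v.1.1 * y.1.1 + e * s * v.1.2 * y.1.2
  + 2^-1 * (v.1.2 * y.2 - v.2 * y.1.2) + e * v.2 * y.2.

Definition gam1 (P v y : R * R * R) : R :=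
  - e * c * (v.1.1 * y.1.2 + v.1.2 * y.1.1)
  - s * (P.1.1 - 2^-1 * c) * v.1.1 * y.2 + 2^-1 * s * c * v.2 * y.1.1
  + P.1.2 * v.1.2 * y.2 + s * P.2 * v.2 * y.2.

Definition gam2 (P v y : R * R * R) : R :=
  - e * c * (v.1.1 * y.2 + v.2 * y.1.1)
  + (P.1.1 - 2^-1 * c) * v.1.1 * y.1.2 - 2^-1 * c * v.1.2 * y.1.1
  - s * P.1.2 * v.1.2 * y.1.2 - P.2 * v.2 * y.1.2.

Definition co q v : R * R * R := (co0 q v, co1 q v, co2 q v).
Definition par q : R * R * R := (a q, b1 q, b2 q).
Definition dpar v : R * R * R := (v a, v b1, v b2).

Definition frame_conn : connection M := fun q v Y => comb q
  (v (fun r => co0 r (Y r)) + gam0 (co q v) (co q (Y q)))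
  (v (fun r => co1 r (Y r)) + gam1 (par q) (co q v) (co q (Y q)))
  (v (fun r => co2 r (Y r)) + gam2 (par q) (co q v) (co q (Y q))).

Lemma near_coK q Y : U q -> vsmooth q Y -> \forall r \near q,
  Y r = comb r (co0 r (Y r)) (co1 r (Y r)) (co2 r (Y r)).
Proof.
by move=> Uq sY; apply: filterS2 (near_ad Uq) (near_tangent sY) => r; exact: coK.
Qed.

(** The coordinates of [Y] need only be known as germs, and need not be smooth, because tangent
    vectors are local on all functions. *)
Lemma frame_conn_comb q v Y (y0 y1 y2 : M -> R) : U q -> tangent q v ->
  (\forall r \near q, Y r = comb r (y0 r) (y1 r) (y2 r)) ->
  let y := (y0 q, y1 q, y2 q) in
  frame_conn q v Y = comb q (v y0 + gam0 (co q v) y) (v y1 + gam1 (par q) (co q v) y)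
                    (v y2 + gam2 (par q) (co q v) y).
Proof.
move=> Uq tv eY y; rewrite /frame_conn.
have -> : co q (Y q) = y.
  by rewrite /co (nbhs_singleton eY); have [-> -> ->] := co_comb (y0 q) (y1 q) (y2 q) Uq.
have E : \forall r \near q, [/\ co0 r (Y r) = y0 r, co1 r (Y r) = y1 r & co2 r (Y r) = y2 r].
  by apply: filterS2 eY (near_ad Uq) => r -> Ur; exact: co_comb.
congr (comb _ (_ + _) (_ + _) (_ + _)); apply: (tangent_near_eq tv);
  by apply: filterS E => r [].
Qed.

Lemma tangent_frame_conn q v Y : U q -> tangent q (frame_conn q v Y).
Proof. exact: tangent_comb. Qed.

Lemma co_lin q (x y : R) v w : U q -> tangent q v -> tangent q w ->
  co q (x *: v + y *: w) = (x * co0 q v + y * co0 q w, x * co1 q v + y * co1 q w,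
    x * co2 q v + y * co2 q w).
Proof. by move=> Uq tv tw; rewrite /co co0_lin// co1_lin// co2_lin. Qed.

Lemma frame_conn_lin q (x : R) v w Y : U q -> tangent q v -> tangent q w ->
  frame_conn q (x *: v + w) Y = x *: frame_conn q v Y + frame_conn q w Y.
Proof.
move=> Uq tv tw; rewrite /frame_conn.
have -> : co q (x *: v + w) = co q (x *: v + 1 *: w) by rewrite scale1r.
rewrite co_lin//; apply/funext => f.
by rewrite !(combE, tvecE) /gam0 /gam1 /gam2 /=; ring.
Qed.

Lemma frame_conn_add q v Y Z : U q -> tangent q v -> vsmooth q Y -> vsmooth q Z ->
  frame_conn q v (fun r => Y r + Z r) = frame_conn q v Y + frame_conn q v Z.
Proof.
move=> Uq tv sY sZ; rewrite (@frame_conn_comb _ _ _ (fun r => co0 r (Y r) + co0 r (Z r))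
  (fun r => co1 r (Y r) + co1 r (Z r)) (fun r => co2 r (Y r) + co2 r (Z r)))//; last first.
  apply: filterS2 (near_coK Uq sY) (near_coK Uq sZ) => r eY eZ.
  by rewrite [in LHS]eY [in LHS]eZ; apply/funext => f; rewrite !(combE, tvecE); ring.
have [y0 y1 y2] := smooth_co Uq sY; have [z0 z1 z2] := smooth_co Uq sZ.
rewrite (tangentD tv y0 z0) (tangentD tv y1 z1) (tangentD tv y2 z2) /frame_conn /co.
by apply/funext => f; rewrite !(combE, tvecE) /gam0 /gam1 /gam2 /=; ring.
Qed.

Lemma frame_conn_leibniz q v f Y : U q -> tangent q v -> smooth_at q f -> vsmooth q Y ->
  frame_conn q v (fun r => f r *: Y r) = f q *: frame_conn q v Y + v f *: Y q.
Proof.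
move=> Uq tv sf sY; rewrite (@frame_conn_comb _ _ _ (fun r => f r * co0 r (Y r))
  (fun r => f r * co1 r (Y r)) (fun r => f r * co2 r (Y r)))//; last first.
  apply: filterS (near_coK Uq sY) => r eY.
  by rewrite [in LHS]eY; apply/funext => g; rewrite !(combE, tvecE); ring.
have [y0 y1 y2] := smooth_co Uq sY.
rewrite (tangentM tv sf y0) (tangentM tv sf y1) (tangentM tv sf y2) /frame_conn.
apply/funext => g.
have eYg : Y q g = co0 q (Y q) * E0 q g + co1 q (Y q) * E1 q g + co2 q (Y q) * E2 q g.
  by rewrite -combE -coK//; exact: vsmooth_tangent.
by rewrite !(combE, tvecE) eYg /gam0 /gam1 /gam2 /=; ring.
Qed.

Lemma smooth_gam q (v0 v1 v2 y0 y1 y2 : M -> R) : U q ->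
  smooth_at q v0 -> smooth_at q v1 -> smooth_at q v2 ->
  smooth_at q y0 -> smooth_at q y1 -> smooth_at q y2 ->
  let v r := (v0 r, v1 r, v2 r) in let y r := (y0 r, y1 r, y2 r) in
  [/\ smooth_at q (fun r => gam0 (v r) (y r)),
      smooth_at q (fun r => gam1 (par r) (v r) (y r))
    & smooth_at q (fun r => gam2 (par r) (v r) (y r))].
Proof.
move=> Uq sv0 sv1 sv2 sy0 sy1 sy2 v y.
have sa := ad_a ad Uq; have sb1 := ad_b1 ad Uq; have sb2 := ad_b2 ad Uq.
have sc x : smooth_at q (fun=> x : R) := smooth_cst q x.
by rewrite /gam0 /gam1 /gam2 /par /=; split;
   repeat first [exact: sc | assumption | apply: smoothD | apply: smoothM | apply: smoothN].
Qed.

Lemma vsmooth_frame_conn q X Y : U q -> vsmooth q X -> vsmooth q Y ->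
  vsmooth q (cov frame_conn X Y).
Proof.
move=> Uq sX sY; have [x0 x1 x2] := smooth_co Uq sX; have [y0 y1 y2] := smooth_co Uq sY.
have [g0 g1 g2] := smooth_gam Uq x0 x1 x2 y0 y1 y2.
by apply: vsmooth_comb => //; apply: smoothD => //; apply: (smooth_app sX).
Qed.

(** * Torsion and metric derivative of the frame connection *)

Lemma metric_comb2 q x0 x1 x2 y0 y1 y2 : U q ->
  G q (comb q x0 x1 x2) (comb q y0 y1 y2) = c * x0 * y0 + s * x1 * y1 + x2 * y2.
Proof.
move=> Uq; have t0 := @tE0 q Uq; have t1 := @tE1 q Uq; have t2 := @tE2 q Uq.
have tc := @tangent_comb q y0 y1 y2 Uq.
rewrite metric_comb// !(metricC hG _ tc)// !metric_comb//.
rewrite (metricC hG t1 t0) // (metricC hG t2 t0) // (metricC hG t2 t1)//.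
rewrite (ad_00 ad)// (ad_01 ad)// (ad_02 ad)// (ad_11 ad)// (ad_12 ad)// (ad_22 ad)//.
by ring.
Qed.

Lemma lie_co q X Y : U q -> vsmooth q X -> vsmooth q Y ->
  let x := co q (X q) in let y := co q (Y q) in
  let w01 := x.1.1 * y.1.2 - x.1.2 * y.1.1 in
  let w02 := x.1.1 * y.2 - x.2 * y.1.1 in
  let w12 := x.1.2 * y.2 - x.2 * y.1.2 in
  lie X Y q = comb q
    (X q (fun r => co0 r (Y r)) - Y q (fun r => co0 r (X r)) + w12)
    (X q (fun r => co1 r (Y r)) - Y q (fun r => co1 r (X r)) - s * a q * w02 + b1 q * w12)
    (X q (fun r => co2 r (Y r)) - Y q (fun r => co2 r (X r)) + a q * w01 + b2 q * w12).
Proof.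
move=> Uq sX sY; have [x0 x1 x2] := smooth_co Uq sX; have [y0 y1 y2] := smooth_co Uq sY.
exact: lie_comb (near_coK Uq sX) (near_coK Uq sY).
Qed.

Lemma frame_conn_torsion q X Y : U q -> vsmooth q X -> vsmooth q Y ->
  cov frame_conn X Y q - cov frame_conn Y X q = lie X Y q.
Proof.
move=> Uq sX sY; rewrite lie_co//; apply/funext => f.
rewrite /cov /frame_conn !(combE, tvecE) /gam0 /gam1 /gam2 /co /par /=.
by field.
Qed.

(** In the frame, [G] has the constant coefficients [c], [s], 1, so differentiating G(Y, Z) touches
    only coordinates. What is left is the algebraic identity G(gam v y, z) + G(y, gam v z) = - 2 e c
    v0 G(y, z). *)
Lemma frame_conn_metric q X Y Z : U q -> vsmooth q X -> vsmooth q Y -> vsmooth q Z ->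
  metric_derivative frame_conn G X Y Z q = 2 * e * c * co0 q (X q) * G q (Y q) (Z q).
Proof.
move=> Uq sX sY sZ; have tX := vsmooth_tangent sX.
have eY := near_coK Uq sY; have eZ := near_coK Uq sZ.
have [y0 y1 y2] := smooth_co Uq sY; have [z0 z1 z2] := smooth_co Uq sZ.
rewrite /metric_derivative.
have -> : app X (fun r => G r (Y r) (Z r)) q =
  X q (fun r => c * co0 r (Y r) * co0 r (Z r) + s * co1 r (Y r) * co1 r (Z r)
    + co2 r (Y r) * co2 r (Z r)).
  apply: (tangent_near_eq tX).
  near=> r; rewrite (near eY r)// (near eZ r)// metric_comb2//; last by near: r; exact: near_ad.
  have Ur : U r by near: r; exact: near_ad.
  have [-> -> ->] := co_comb (co0 r (Y r)) (co1 r (Y r)) (co2 r (Y r)) Ur.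
  by have [-> -> ->] := co_comb (co0 r (Z r)) (co1 r (Z r)) (co2 r (Z r)) Ur.
have [_ ->] : dval q (X q) (fun r => c * co0 r (Y r) * co0 r (Z r)
    + s * co1 r (Y r) * co1 r (Z r) + co2 r (Y r) * co2 r (Z r))
    (c * (co0 q (Y q) * X q (fun r => co0 r (Z r)) + co0 q (Z q) * X q (fun r => co0 r (Y r)))
    + s * (co1 q (Y q) * X q (fun r => co1 r (Z r)) + co1 q (Z q) * X q (fun r => co1 r (Y r)))
    + (co2 q (Y q) * X q (fun r => co2 r (Z r)) + co2 q (Z q) * X q (fun r => co2 r (Y r)))).
  apply: dval_eq; first by
    apply: (dvalD tX); first apply: (dvalD tX);
    first (apply: (dvalM tX); first (apply: (dvalM tX); first exact: dval_cst tX);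
      exact: dval_app);
    first (apply: (dvalM tX); first (apply: (dvalM tX); first exact: dval_cst tX);
      exact: dval_app);
    apply: (dvalM tX); exact: dval_app.
  by rewrite /=; ring.
have eG v w : tangent q v -> tangent q w -> G q v w =
    c * co0 q v * co0 q w + s * co1 q v * co1 q w + co2 q v * co2 q w.
  by move=> tv tw; rewrite {1}(coK Uq tv) {1}(coK Uq tw) metric_comb2.
have tY := vsmooth_tangent sY; have tZ := vsmooth_tangent sZ.
rewrite !eG//; try exact: tangent_frame_conn.
rewrite /cov /frame_conn.
set A0 := X q _ + _; set A1 := X q _ + _; set A2 := X q _ + _.
set B0 := X q _ + gam0 _ (co q (Z q)); set B1 := X q _ + gam1 _ _ (co q (Z q)).
set B2 := X q _ + gam2 _ _ (co q (Z q)).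
have [-> -> ->] := co_comb A0 A1 A2 Uq; have [-> -> ->] := co_comb B0 B1 B2 Uq.
rewrite /A0 /A1 /A2 /B0 /B1 /B2 /gam0 /gam1 /gam2 /co /par /=.
by field: ss.
Unshelve. all: by end_near. Qed.

(* [lgam1] and [lgam2] are the parts of [gam1] and [gam2] linear in [P]. *)
Definition lgam1 (P v y : R * R * R) : R :=
  - s * P.1.1 * v.1.1 * y.2 + P.1.2 * v.1.2 * y.2 + s * P.2 * v.2 * y.2.

Definition lgam2 (P v y : R * R * R) : R :=
  P.1.1 * v.1.1 * y.1.2 - s * P.1.2 * v.1.2 * y.1.2 - P.2 * v.2 * y.1.2.

Definition gam (P v y : R * R * R) : R * R * R := (gam0 v y, gam1 P v y, gam2 P v y).

(** The bracket of two combinations of the frame with constant coordinates [x] and [y]. *)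
Definition tor (P x y : R * R * R) : R * R * R :=
  let w01 := x.1.1 * y.1.2 - x.1.2 * y.1.1 in
  let w02 := x.1.1 * y.2 - x.2 * y.1.1 in
  let w12 := x.1.2 * y.2 - x.2 * y.1.2 in
  (w12, - s * P.1.1 * w02 + P.1.2 * w12, P.1.1 * w01 + P.2 * w12).

(* Components of [R(x, y)z]; [dx] and [dy] are the derivatives of [(a, b1, b2)]
   along [x] and [y].  No derivative of [x], [y], [z] occurs, so the formula gives
   the tensoriality of the curvature as well as its value. *)
Definition curv0 (P x y z : R * R * R) : R :=
  gam0 x (gam P y z) - gam0 y (gam P x z) - gam0 (tor P x y) z.

Definition curv1 (P dx dy x y z : R * R * R) : R :=
  lgam1 dx y z - lgam1 dy x z
  + gam1 P x (gam P y z) - gam1 P y (gam P x z) - gam1 P (tor P x y) z.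

Definition curv2 (P dx dy x y z : R * R * R) : R :=
  lgam2 dx y z - lgam2 dy x z
  + gam2 P x (gam P y z) - gam2 P y (gam P x z) - gam2 P (tor P x y) z.

(** The Christoffel terms are bilinear in the two vectors and affine in [P]. Differentiating [P]
    therefore keeps only its linear part, which is why [lgam1] and [lgam2] appear. *)
Lemma dval_gam q v (x0 x1 x2 y0 y1 y2 : M -> R) : U q -> tangent q v ->
  smooth_at q x0 -> smooth_at q x1 -> smooth_at q x2 ->
  smooth_at q y0 -> smooth_at q y1 -> smooth_at q y2 ->
  let x r := (x0 r, x1 r, x2 r) in let y r := (y0 r, y1 r, y2 r) in
  let dx := (v x0, v x1, v x2) in let dy := (v y0, v y1, v y2) in
  [/\ v (fun r => gam0 (x r) (y r)) = gam0 dx (y q) + gam0 (x q) dy,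
      v (fun r => gam1 (par r) (x r) (y r)) =
        lgam1 (dpar v) (x q) (y q) + gam1 (par q) dx (y q) + gam1 (par q) (x q) dy
    & v (fun r => gam2 (par r) (x r) (y r)) =
        lgam2 (dpar v) (x q) (y q) + gam2 (par q) dx (y q) + gam2 (par q) (x q) dy].
Proof.
move=> Uq tv sx0 sx1 sx2 sy0 sy1 sy2 x y dx dy.
have sa := ad_a ad Uq; have sb1 := ad_b1 ad Uq; have sb2 := ad_b2 ad Uq.
have dvE f d d' : dval q v f d -> d = d' -> v f = d' by case=> _ ->.
split; (apply: dvE; first by rewrite /gam0 /gam1 /gam2 /par /=;
  repeat first [apply: (dval_cst _ tv) | apply: dval_app; assumption
    | apply: (dvalD tv) | apply: (dvalM tv) | apply: (dvalN tv)]);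
  rewrite /dx /dy /x /y /dpar /gam0 /gam1 /gam2 /lgam1 /lgam2 /par /=; ring.
Qed.

Definition dco (v : tvec M) Y : R * R * R :=
  (v (fun r => co0 r (Y r)), v (fun r => co1 r (Y r)), v (fun r => co2 r (Y r))).

(** Isolates the second derivatives of the coordinates of [Z], the terms that the bracket removes in
    the curvature. *)
Lemma frame_conn_nf q X Y Z : U q -> vsmooth q X -> vsmooth q Y -> vsmooth q Z ->
  let x := co q (X q) in let y := co q (Y q) in let z := co q (Z q) in
  let Yz := dco (Y q) Z in let P := par q in let dx := dpar (X q) in
  let W := (Yz.1.1 + gam0 y z, Yz.1.2 + gam1 P y z, Yz.2 + gam2 P y z) in
  frame_conn q (X q) (cov frame_conn Y Z) = comb q
    (X q (app Y (fun r => co0 r (Z r))) + (gam0 (dco (X q) Y) z + gam0 y (dco (X q) Z))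
     + gam0 x W)
    (X q (app Y (fun r => co1 r (Z r))) + (lgam1 dx y z + gam1 P (dco (X q) Y) z
     + gam1 P y (dco (X q) Z)) + gam1 P x W)
    (X q (app Y (fun r => co2 r (Z r))) + (lgam2 dx y z + gam2 P (dco (X q) Y) z
     + gam2 P y (dco (X q) Z)) + gam2 P x W).
Proof.
move=> Uq sX sY sZ x y z Yz P dx W; have tX := vsmooth_tangent sX.
have [y0 y1 y2] := smooth_co Uq sY; have [z0 z1 z2] := smooth_co Uq sZ.
have [g0 g1 g2] := smooth_gam Uq y0 y1 y2 z0 z1 z2.
have [d0 d1 d2] := dval_gam Uq tX y0 y1 y2 z0 z1 z2.
rewrite (@frame_conn_comb _ _ _
  (fun r => app Y (fun r => co0 r (Z r)) r + gam0 (co r (Y r)) (co r (Z r)))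
  (fun r => app Y (fun r => co1 r (Z r)) r + gam1 (par r) (co r (Y r)) (co r (Z r)))
  (fun r => app Y (fun r => co2 r (Z r)) r + gam2 (par r) (co r (Y r)) (co r (Z r))))//;
  last exact: nearW.
rewrite (tangentD tX (smooth_app sY z0) g0) (tangentD tX (smooth_app sY z1) g1).
by rewrite (tangentD tX (smooth_app sY z2) g2) d0 d1 d2.
Qed.

Lemma frame_conn_curvature q X Y Z : U q -> vsmooth q X -> vsmooth q Y -> vsmooth q Z ->
  let x := co q (X q) in let y := co q (Y q) in let z := co q (Z q) in
  let P := par q in let dx := dpar (X q) in let dy := dpar (Y q) in
  curvature_field frame_conn X Y Z q =
  comb q (curv0 P x y z) (curv1 P dx dy x y z) (curv2 P dx dy x y z).
Proof.
move=> Uq sX sY sZ x y z P dx dy.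
have [z0 z1 z2] := smooth_co Uq sZ.
have el : co q (lie X Y q) =
    ((dco (X q) Y).1.1 - (dco (Y q) X).1.1 + (tor P x y).1.1,
     (dco (X q) Y).1.2 - (dco (Y q) X).1.2 + (tor P x y).1.2,
     (dco (X q) Y).2 - (dco (Y q) X).2 + (tor P x y).2).
  rewrite lie_co// /co.
  set l0 := X q _ - _ + _; set l1 := X q _ - _ - _ + _; set l2 := X q _ - _ + _ + _.
  have [-> -> ->] := co_comb l0 l1 l2 Uq.
  by rewrite /l0 /l1 /l2 /tor /=; congr (_, _, _); ring.
rewrite /curvature_field {1}/cov frame_conn_nf// {1}/cov frame_conn_nf//.
rewrite {1}/cov /frame_conn el !lieE//.
apply/funext => f; rewrite !(combE, tvecE) -/x -/y -/z -/P -/dx -/dy.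
(* All derivatives become independent reals. Those of second order cancel against the [lieE] terms,
   and the first derivatives of the coordinates of [X] and [Y] against [el]: a polynomial
   identity. *)
move: (X q (app Y _)) (X q (app Y _)) (X q (app Y _)) => XY0 XY1 XY2.
move: (Y q (app X _)) (Y q (app X _)) (Y q (app X _)) => YX0 YX1 YX2.
move: (dco (X q) Y) (dco (Y q) X) (dco (X q) Z) (dco (Y q) Z) => Xy Yx Xz Yz.
move: (E0 q f) (E1 q f) (E2 q f) => e0 e1 e2.
clearbody x y z P dx dy.
rewrite /curv0 /curv1 /curv2 /gam /gam0 /gam1 /gam2 /lgam1 /lgam2 /=.
ring.
Qed.

End Frame.
End Adapted.

(** * Uniqueness of Weyl connections, traces *)

Section Weyl.
Context {R : realType} {M : manifold3 R} (G : M -> tvec M -> tvec M -> R).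
Hypothesis hG : pseudo_metric G.
Variable eta : M -> tvec M -> R.
Implicit Types (nab : connection M) (p q : M) (X Y Z : vfield M).

(** Keeps just what uniqueness at [q] uses, so that it can hold for [frame_conn], which is a
    connection only over the domain of its frame. *)
Definition weyl_at nab q :=
  [/\ forall X Y, vsmooth q X -> vsmooth q Y -> tangent q (cov nab X Y q),
      forall X Y, vsmooth q X -> vsmooth q Y ->
        cov nab X Y q - cov nab Y X q = lie X Y q
    & forall X Y Z, vsmooth q X -> vsmooth q Y -> vsmooth q Z ->
        metric_derivative nab G X Y Z q = eta q (X q) * G q (Y q) (Z q)].

Lemma near_common q X Y Z : vsmooth q X -> vsmooth q Y -> vsmooth q Z ->
  exists U, [/\ open U, U q, smooth_vfield U X, smooth_vfield U Y & smooth_vfield U Z].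
Proof.
move=> sX sY sZ; have [U [oU Uq HU]] := (nbhs_openP _ _).1 (filterI (near_vsmooth sX)
  (filterI (near_vsmooth sY) (near_vsmooth sZ))).
by exists U; split=> //; apply/(smooth_vfieldP _ oU) => r /HU[? []].
Qed.

Lemma vsmooth_cov nab q X Y : is_connection nab -> vsmooth q X -> vsmooth q Y ->
  vsmooth q (cov nab X Y).
Proof.
move=> [_ _ _ h] sX sY; have [U [oU Uq XU YU _]] := near_common sX sY sY.
by exists U; split=> //; exact: h.
Qed.

Lemma weyl_connection_at nab q : weyl_connection G eta nab -> weyl_at nab q.
Proof.
move=> [hc ht hm]; split=> [X Y sX sY|X Y sX sY|X Y Z sX sY sZ].
- exact: vsmooth_tangent (vsmooth_cov hc sX sY).
- by have [U [oU Uq XU YU _]] := near_common sX sY sY; exact: ht XU YU _ Uq.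
by have [U [oU Uq XU YU ZU]] := near_common sX sY sZ; exact: hm XU YU ZU _ Uq.
Qed.

(* The difference of two such connections is symmetric in its two arguments and
   antisymmetric for [G] in its last argument and value, hence zero. *)
Lemma weyl_unique nab nab' q :
  (forall v, tangent q v -> exists2 Z, vsmooth q Z & Z q = v) ->
  weyl_at nab q -> weyl_at nab' q ->
  forall X Y, vsmooth q X -> vsmooth q Y -> cov nab X Y q = cov nab' X Y q.
Proof.
move=> ext [t1 tor1 m1] [t2 tor2 m2].
pose A X Y := cov nab X Y q - cov nab' X Y q.
have tA X Y : vsmooth q X -> vsmooth q Y -> tangent q (A X Y).
  by move=> sX sY; apply: tangent_sub; [exact: t1|exact: t2].
have Asym X Y : vsmooth q X -> vsmooth q Y -> A X Y = A Y X.
  move=> sX sY; have := tor1 X Y sX sY; rewrite -(tor2 X Y sX sY) => h.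
  apply/funext => f; have /(congr1 (fun v : tvec M => v f : R)) := h.
  rewrite /A !tvecE => hf; lra.
pose g X Y Z := G q (A X Y) (Z q).
have gsym X Y Z : vsmooth q X -> vsmooth q Y -> g X Y Z = g Y X Z.
  by move=> sX sY; rewrite /g Asym.
have ganti X Y Z : vsmooth q X -> vsmooth q Y -> vsmooth q Z -> g X Y Z = - g X Z Y.
  move=> sX sY sZ; have := m1 X Y Z sX sY sZ; rewrite -(m2 X Y Z sX sY sZ).
  have tY := vsmooth_tangent sY; have tZ := vsmooth_tangent sZ.
  have a1 := t1 X Y sX sY; have a2 := t2 X Y sX sY.
  have a3 := t1 X Z sX sZ; have a4 := t2 X Z sX sZ.
  rewrite /metric_derivative /g /A !(metricBl hG)//.
  rewrite !(metricC hG tY)//; lra.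
have g0 X Y Z : vsmooth q X -> vsmooth q Y -> vsmooth q Z -> g X Y Z = 0.
  move=> sX sY sZ.
  (* Alternating the two symmetries permutes the arguments through all six orders and returns to
     [g X Y Z] after three sign changes. *)
  have h1 := ganti X Y Z sX sY sZ; have h2 := gsym X Z Y sX sZ.
  have h3 := ganti Z X Y sZ sX sY; have h4 := gsym Z Y X sZ sY.
  have h5 := ganti Y Z X sY sZ sX; have h6 := gsym Y X Z sY sX.
  lra.
move=> X Y sX sY; apply/subr0_eq; apply: (metric_nondeg hG (tA X Y sX sY)) => w tw.
by have [Z sZ <-] := ext w tw; exact: g0.
Qed.

End Weyl.

Section Trace.
Context {R : realType} {M : manifold3 R}.
Implicit Types (p : M) (v w : tvec M) (L : tvec M -> tvec M) (e : 'I_3 -> tvec M).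

Lemma basis3_inj p e (x y : 'I_3 -> R) : basis3 p e ->
  \sum_i x i *: e i = \sum_i y i *: e i -> x =1 y.
Proof.
move=> [_ free _] /eqP; rewrite -subr_eq0 -sumrB => /eqP h i; apply/subr0_eq.
apply: (free (fun i => x i - y i)); rewrite -[RHS]h; apply: eq_bigr => j _.
by rewrite scalerBl.
Qed.

Lemma linear_sum3 (V : lmodType R) p (L : tvec M -> V) e (x : 'I_3 -> R) :
  (forall (a b : R) v w, tangent p v -> tangent p w ->
    L (a *: v + b *: w) = a *: L v + b *: L w) ->
  (forall i, tangent p (e i)) ->
  L (\sum_i x i *: e i) = \sum_i x i *: L (e i).
Proof.
move=> linL te; rewrite !sum3E -[X in L (X + _)]scale1r linL//.
  by rewrite linL// scale1r.
exact: tangent_lin.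
Qed.

Lemma tangent_sum3 p e (x : 'I_3 -> R) : (forall i, tangent p (e i)) ->
  tangent p (\sum_i x i *: e i).
Proof.
by move=> te; rewrite sum3E; apply: tangent_add; [exact: tangent_lin|exact: tangentZ].
Qed.

(** If [P] expresses [e'] in [e], then A' P = P A with [P] invertible, and the trace is invariant
    under conjugation. This makes the [xget] in [trace] determinate. *)
Lemma trace_unique p L e e' (A A' : 'M[R]_3) :
  (forall (x y : R) v w, tangent p v -> tangent p w ->
    L (x *: v + y *: w) = x *: L v + y *: L w) ->
  basis3 p e -> basis3 p e' ->
  (forall i, L (e i) = \sum_j A i j *: e j) ->
  (forall i, L (e' i) = \sum_j A' i j *: e' j) -> \tr A = \tr A'.
Proof.
move=> linL be be' LA LA'; have [te fe ge] := be; have [te' fe' ge'] := be'.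
have /choice[P eP] : forall i, exists x : 'I_3 -> R, e' i = \sum_j x j *: e j.
  by move=> i; exact: ge.
have /choice[Q eQ] : forall i, exists x : 'I_3 -> R, e i = \sum_j x j *: e' j.
  by move=> i; exact: ge'.
pose mP : 'M[R]_3 := \matrix_(i, j) P i j; pose mQ : 'M[R]_3 := \matrix_(i, j) Q i j.
have Lsum (x : 'I_3 -> R) : L (\sum_j x j *: e j) = \sum_j x j *: L (e j).
  exact: (linear_sum3 x linL te).
have mulE (x y : 'I_3 -> 'I_3 -> R) (f : 'I_3 -> tvec M) i :
    \sum_j x i j *: (\sum_k y j k *: f k) = \sum_k (\sum_j x i j * y j k) *: f k.
  under eq_bigr do rewrite scaler_sumr.
  rewrite exchange_big /=; apply: eq_bigr => k _; rewrite scaler_suml.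
  by apply: eq_bigr => j _; rewrite scalerA.
have QP : mQ *m mP = 1%:M.
  apply/matrixP => i k; rewrite !mxE.
  have /(basis3_inj be)/(_ k) <- : \sum_k (\sum_j Q i j * P j k) *: e k =
      \sum_k (i == k)%:R *: e k.
    rewrite -mulE; under eq_bigr do rewrite -eP.
    rewrite -eQ (bigD1 i)//= eqxx scale1r big1 ?addr0// => j ji.
    by rewrite eq_sym (negbTE ji) scale0r.
  by apply: eq_bigr => j _; rewrite !mxE.
have AP : A' *m mP = mP *m A.
  apply/matrixP => i k; rewrite !mxE.
  have /(basis3_inj be)/(_ k) : \sum_k (\sum_j A' i j * P j k) *: e k =
      \sum_k (\sum_j P i j * A j k) *: e k.
    rewrite -!mulE; under eq_bigr do rewrite -eP.
    rewrite -LA' [in LHS]eP Lsum; apply: eq_bigr => j _.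
    by rewrite LA.
  move=> h; transitivity (\sum_j P i j * A j k); last first.
    by apply: eq_bigr => j _; rewrite !mxE.
  by rewrite -h; apply: eq_bigr => j _; rewrite !mxE.
by rewrite -[A']mulmx1 -(mulmx1C QP) mulmxA AP mxtrace_mulC mulmxA QP mul1mx.
Qed.

Lemma traceE p L e (A : 'M[R]_3) :
  (forall (x y : R) v w, tangent p v -> tangent p w ->
    L (x *: v + y *: w) = x *: L v + y *: L w) ->
  basis3 p e -> (forall i, L (e i) = \sum_j A i j *: e j) -> trace p L = \tr A.
Proof.
move=> linL be LA; apply: xget_unique; first by exists e, A.
by move=> _ [e' [A' [be' LA' ->]]]; symmetry; exact: (trace_unique linL be be' LA LA').
Qed.

(* The trace of the inverse Gram matrix against the antisymmetric part of the
   Ricci form vanishes, so no change of basis is needed. *)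
Lemma scalar_curvature_einstein (G : M -> tvec M -> tvec M -> R) nab p (l : R) :
  pseudo_metric G -> (exists e, @basis3 R M p e) ->
  (forall v w, tangent p v -> tangent p w -> ricci_sym nab p v w = l * G p v w) ->
  scalar_curvature G nab p = 3 * l.
Proof.
move=> hG [e0 be0] hl.
have main e : basis3 p e ->
    \tr (invmx (gram (G p) e) *m gram (ricci nab p) e) = 3 * l.
  move=> be; have [te fe ge] := be; set g := gram (G p) e; set r := gram _ e.
  have gT : g^T = g by apply/matrixP => i j; rewrite !mxE (metricC hG).
  have glin w (x : 'I_3 -> R) : tangent p w ->
      G p (\sum_i x i *: e i) w = \sum_i x i * G p (e i) w.
    move=> tw; apply: (@linear_sum3 R^o _ (fun v => G p v w : R^o)) => // a b v v' tv tv'.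
    exact: metric_linl.
  (* A left kernel vector of the Gram matrix holds the coordinates of a vector orthogonal to the
     whole tangent space. *)
  have ug : g \in unitmx.
    rewrite -row_free_unit -kermx_eq0; apply/eqP/row_matrixP => i.
    rewrite row0; set u := row i _.
    have ug0 : u *m g = 0 by apply/sub_kermxP; exact: row_sub.
    have /fe u0 : \sum_i u 0 i *: e i = 0.
      apply: (metric_nondeg hG); first exact: tangent_sum3.
      move=> w /ge[x ->]; rewrite (metricC hG); try exact: tangent_sum3.
      rewrite glin; last exact: tangent_sum3.
      apply: big1 => j _; rewrite (metricC hG)//; last exact: tangent_sum3.
      rewrite glin//; have /matrixP/(_ 0 j) := ug0; rewrite !mxE => h.
      by under eq_bigr => i' _ do [have -> : G p (e i') (e j) = g i' j by rewrite mxE];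
        rewrite h mulr0.
    by apply/rowP => j; rewrite u0 mxE.
  have rr : r + r^T = (2 * l) *: g.
    apply/matrixP => i j; rewrite !mxE.
    by have := hl _ _ (te i) (te j); rewrite /ricci_sym => h; lra.
  have : \tr (invmx g *m (r + r^T)) = 2 * (3 * l).
    rewrite rr -scalemxAr mulVmx// mxtraceZ mxtrace1; ring.
  have -> : \tr (invmx g *m (r + r^T)) = 2 * \tr (invmx g *m r).
    rewrite mulmxDr mxtraceD -[X in _ + X]mxtrace_tr trmx_mul trmxK trmx_inv gT mxtrace_mulC.
    by ring.
  by move=> h; lra.
apply: xget_unique; first by exists e0 => //; rewrite main.
by move=> _ [e be ->]; exact: main.
Qed.

End Trace.

(** * Curvature and Ricci form *)

Section WeylFrame.
Context {R : realType} {M : manifold3 R} (G : M -> tvec M -> tvec M -> R).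
Variables (s c e : R) (E0 : vfield M) (eta : M -> tvec M -> R).
Hypothesis hG : pseudo_metric G.
Hypothesis c0 : c != 0.
Hypothesis ss : s * s = 1.
Hypothesis etaE : forall q v, tangent q v -> eta q v = 2 * e * c * co0 G c E0 q v.
Implicit Types (p q : M) (v w : tvec M) (X Y Z : vfield M) (f : M -> R).

Section Frame.
Variables (U : set M) (E1 E2 : vfield M) (a b1 b2 : M -> R).
Hypothesis ad : adapted G s c E0 U E1 E2 a b1 b2.
Local Notation comb := (comb E0 E1 E2).
Local Notation co := (co G s c E0 E1 E2).
Local Notation frame_conn := (frame_conn G s c e E0 E1 E2 a b1 b2).
Local Notation par := (par a b1 b2).
Local Notation dpar := (dpar a b1 b2).

Lemma frame_extend q v : U q -> tangent q v -> exists2 Z, vsmooth q Z & Z q = v.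
Proof.
move=> Uq tv; exists (fun r => comb r (co q v).1.1 (co q v).1.2 (co q v).2).
  by apply: (vsmooth_comb ad Uq); exact: smooth_cst.
by rewrite -(coK hG c0 ss ad Uq tv).
Qed.

Lemma frame_conn_weyl_at q : U q -> weyl_at G eta frame_conn q.
Proof.
move=> Uq; split=> [X Y sX sY|X Y sX sY|X Y Z sX sY sZ].
- exact: (tangent_frame_conn e ad).
- exact: (frame_conn_torsion e hG c0 ss ad).
by rewrite (frame_conn_metric e hG c0 ss ad)// etaE//; exact: vsmooth_tangent.
Qed.

(** These are the [E1] and [E2] components of the Jacobi identity; the [E0] component is trivial.
    They trade derivatives along [E0] for derivatives of [a]. *)
Lemma jacobi_par q : U q ->
  E0 q b1 = s * a q * b2 q - s * E1 q a /\ E0 q b2 = - a q * b1 q - E2 q a.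
Proof.
move=> Uq; have nU := near_ad ad Uq.
have v0 := ad_E0 ad Uq; have v1 := ad_E1 ad Uq; have v2 := ad_E2 ad Uq.
have sa := ad_a ad Uq; have sb1 := ad_b1 ad Uq; have sb2 := ad_b2 ad Uq.
have sc x : smooth_at q (fun=> x : R) := smooth_cst q x.
have ssa : smooth_at q (fun r => s * a r) by exact: smoothM.
pose A r := comb r 1 (b1 r) (b2 r).
pose B r := comb r 0 (s * a r) 0.
pose C r := comb r 0 0 (a r).
have tA : tangent q (A q) := tangent_comb ad _ _ _ Uq.
have tB : tangent q (B q) := tangent_comb ad _ _ _ Uq.
have tC : tangent q (C q) := tangent_comb ad _ _ _ Uq.
have eA : \forall r \near q, A r = lie E1 E2 r.
  apply: filterS nU => r Ur; rewrite (ad_lie12 ad)//.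
  by apply/funext => f; rewrite /A !(combE, tvecE); ring.
have eB : \forall r \near q, B r = lie E2 E0 r.
  apply: filterS nU => r Ur.
  have -> : lie E2 E0 r = - lie E0 E2 r.
    by apply/funext => f; rewrite tvecN /lie; case: asboolP => _; rewrite ?opprB ?oppr0.
  rewrite (ad_lie02 ad)//.
  by apply/funext => f; rewrite /B !(combE, tvecE); ring.
have eC : \forall r \near q, C r = lie E0 E1 r.
  apply: filterS nU => r Ur; rewrite (ad_lie01 ad)//.
  by apply/funext => f; rewrite /C !(combE, tvecE); ring.
have d0 x : E0 q (fun=> x) = 0 :> R := tangent_cst x (vsmooth_tangent v0).
have d1 x : E1 q (fun=> x) = 0 :> R := tangent_cst x (vsmooth_tangent v1).
have d2 x : E2 q (fun=> x) = 0 :> R := tangent_cst x (vsmooth_tangent v2).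
have dA := tangent_cst _ tA; have dB := tangent_cst _ tB;
have dC x : C q (fun=> x) = 0 :> R := tangent_cst x tC.
have c100 : \forall r \near q, E0 r = comb r 1 0 0.
  by apply: nearW => r; apply/funext => f; rewrite combE; ring.
have c010 : \forall r \near q, E1 r = comb r 0 1 0.
  by apply: nearW => r; apply/funext => f; rewrite combE; ring.
have c001 : \forall r \near q, E2 r = comb r 0 0 1.
  by apply: nearW => r; apply/funext => f; rewrite combE; ring.
have self (X : vfield M) : \forall r \near q, X r = X r by exact: nearW.
have l0 := lie_comb ad Uq (sc 1) (sc 0) (sc 0) (sc 1) sb1 sb2 c100 (self A).
have l1 := lie_comb ad Uq (sc 0) (sc 1) (sc 0) (sc 0) ssa (sc 0) c010 (self B).
have l2 := lie_comb ad Uq (sc 0) (sc 0) (sc 1) (sc 0) (sc 0) sa c001 (self C).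
have e1 : E1 q (fun r => s * a r) = s * E1 q a.
  by rewrite (tangentM (vsmooth_tangent v1) (sc s) sa) d1 mulr0 addr0.
rewrite /= !(d0, d1, d2, dA, dB, dC) e1 in l0 l1 l2.
have J f : smooth_at q f -> comb q 0 (E0 q b1 - s * a q * b2 q + s * E1 q a)
   (E0 q b2 + a q * b1 q + E2 q a) f = 0.
  move=> sf; transitivity (lie E0 A q f + lie E1 B q f + lie E2 C q f : R).
    by rewrite l0 l1 l2 !combE; ring.
  exact: (lie_jacobi v0 v1 v2 eA eB eC sf).
have : comb q 0 (E0 q b1 - s * a q * b2 q + s * E1 q a)
   (E0 q b2 + a q * b1 q + E2 q a) = comb q 0 0 0.
  apply: tvec_eqP; try exact: (tangent_comb ad).
  by move=> f sf; rewrite J// combE; ring.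
move=> /(comb_inj hG c0 ss ad Uq)[_ j1 j2]; split; lra.
Qed.

Lemma dpar_co q v : U q -> tangent q v -> let x := co q v in
  dpar v = (x.1.1 * E0 q a + x.1.2 * E1 q a + x.2 * E2 q a,
            x.1.1 * E0 q b1 + x.1.2 * E1 q b1 + x.2 * E2 q b1,
            x.1.1 * E0 q b2 + x.1.2 * E1 q b2 + x.2 * E2 q b2).
Proof. by move=> Uq tv x; rewrite [in LHS](coK hG c0 ss ad Uq tv). Qed.

Variable nab : connection M.
Hypothesis nabC : is_connection nab.
Hypothesis nabW : forall q, weyl_at G eta nab q.

Lemma cov_frame_conn q X Y : U q -> vsmooth q X -> vsmooth q Y ->
  cov nab X Y q = cov frame_conn X Y q.
Proof.
move=> Uq; apply: (weyl_unique hG) (nabW q) (frame_conn_weyl_at Uq) X Y => v.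
exact: frame_extend.
Qed.

Lemma frame_conn_near q v X Y : U q -> tangent q v -> vsmooth q X ->
  (\forall r \near q, Y r = X r) -> frame_conn q v Y = frame_conn q v X.
Proof.
move=> Uq tv sX YX.
have eX := near_coK hG c0 ss ad Uq sX.
have eY : \forall r \near q, Y r = comb r (co r (X r)).1.1 (co r (X r)).1.2 (co r (X r)).2.
  by apply: filterS2 YX eX => r ->.
by rewrite (frame_conn_comb e hG c0 ss ad Uq tv eX)
  (frame_conn_comb e hG c0 ss ad Uq tv eY).
Qed.

(** In an iterated derivative, agreement of the inner fields at [q] is not enough: they must agree
    nearby, which uniqueness at each nearby point provides. *)
Lemma curvature_field_frame_conn q X Y Z : U q -> vsmooth q X -> vsmooth q Y -> vsmooth q Z ->
  curvature_field nab X Y Z q = curvature_field frame_conn X Y Z q.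
Proof.
move=> Uq sX sY sZ; rewrite /curvature_field.
have nU := near_ad ad Uq.
have key (V W : vfield M) : vsmooth q V -> vsmooth q W ->
    cov nab V (cov nab W Z) q = cov frame_conn V (cov frame_conn W Z) q.
  move=> sV sW; rewrite cov_frame_conn//; last exact: vsmooth_cov.
  apply: frame_conn_near => //; first exact: vsmooth_tangent.
    exact: (vsmooth_frame_conn e hG ad).
  near=> r; apply: cov_frame_conn; first by near: r.
  - by near: r; exact: near_vsmooth.
  - by near: r; exact: near_vsmooth.
rewrite !key//; congr (_ - _); apply: cov_frame_conn => //.
apply: vsmooth_lie => //; near=> r.
have Ur : U r by near: r.
rewrite (lie_co hG c0 ss ad)//; first exact: (tangent_comb ad).
  by near: r; exact: near_vsmooth.
by near: r; exact: near_vsmooth.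
Unshelve. all: by end_near. Qed.

(** Every admissible choice of extensions gives the right-hand side, which depends only on their
    values at [q]; so the [xget] has a single candidate. *)
Lemma curvatureE q u v w : U q -> tangent q u -> tangent q v -> tangent q w ->
  curvature nab q u v w =
  comb q (curv0 s c e (par q) (co q u) (co q v) (co q w))
    (curv1 s c e (par q) (dpar u) (dpar v) (co q u) (co q v) (co q w))
    (curv2 s c e (par q) (dpar u) (dpar v) (co q u) (co q v) (co q w)).
Proof.
move=> Uq tu tv tw; apply: xget_unique.
  have [X sX Xu] := frame_extend Uq tu; have [Y sY Yv] := frame_extend Uq tv.
  have [Z sZ Zw] := frame_extend Uq tw.
  have [V [oV Vq XV YV ZV]] := near_common sX sY sZ.
  exists V, X, Y, Z; split=> //.
  by rewrite curvature_field_frame_conn// (frame_conn_curvature e hG c0 ss ad)// Xu Yv Zw.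
move=> _ [V [X [Y [Z [oV Vq [XV YV ZV] [<- <- <-] ->]]]]].
have vs (W : vfield M) : smooth_vfield V W -> vsmooth q W by exists V.
by rewrite curvature_field_frame_conn ?(frame_conn_curvature e hG c0 ss ad)//; exact: vs.
Qed.

Lemma ricciE q v w : U q -> tangent q v -> tangent q w ->
  let r i := (curv0 s c e (par q) (co q i) (co q v) (co q w),
    curv1 s c e (par q) (dpar i) (dpar v) (co q i) (co q v) (co q w),
    curv2 s c e (par q) (dpar i) (dpar v) (co q i) (co q v) (co q w)) in
  ricci nab q v w = (r (E0 q)).1.1 + (r (E1 q)).1.2 + (r (E2 q)).2.
Proof.
move=> Uq tv tw r; rewrite /ricci.
have t0 := @tE0 _ _ _ _ _ _ _ _ _ _ _ _ ad q Uq.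
have t1 := @tE1 _ _ _ _ _ _ _ _ _ _ _ _ ad q Uq.
have t2 := @tE2 _ _ _ _ _ _ _ _ _ _ _ _ ad q Uq.
pose fr := tri (E0 q) (E1 q) (E2 q).
have tfr i : tangent q (fr i) by move: i; exact: forall3.
rewrite (traceE (e := fr) (A := \matrix_(i, j)
  tri (r (fr i)).1.1 (r (fr i)).1.2 (r (fr i)).2 j)).
- by rewrite /mxtrace sum3E !mxE.
- move=> x y u u' tu tu'; rewrite !curvatureE//; last exact: tangent_lin.
  apply/funext => f; rewrite !(combE, tvecE) (co_lin hG ad x y Uq tu tu').
  rewrite /curv0 /curv1 /curv2 /gam /gam0 /gam1 /gam2 /lgam1 /lgam2 /tor /dpar !tvecE /=.
  by ring.
- exact: (frame_basis3 hG c0 ss ad).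
by move=> i; rewrite curvatureE// sum3E !mxE.
Qed.

Lemma ricci_symE q v w (k : R) : U q -> tangent q v -> tangent q w ->
  k = E1 q b2 - s * E2 q b1 - s * b1 q * b1 q - b2 q * b2 q + a q ->
  let y := co q v in let z := co q w in
  ricci_sym nab q v w = s * c / 2 * (c * y.1.1 * z.1.1)
    + (k - c / 2 - s * c * e * e) * (y.1.2 * z.1.2 + s * y.2 * z.2).
Proof.
move=> Uq tv tw -> y z; rewrite /ricci_sym !ricciE//.
have t0 := @tE0 _ _ _ _ _ _ _ _ _ _ _ _ ad q Uq.
have t1 := @tE1 _ _ _ _ _ _ _ _ _ _ _ _ ad q Uq.
have t2 := @tE2 _ _ _ _ _ _ _ _ _ _ _ _ ad q Uq.
rewrite !(dpar_co Uq)// -/y -/z.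
(* Once [E0 q b1] and [E0 q b2] are eliminated, the mixed terms between the [E0] direction and the
   plane cancel. *)
have [j1 j2] := jacobi_par Uq; rewrite j1 j2.
have -> : co q (E0 q) = (1, 0, 0).
  have [h0 h1 h2] := co_comb hG c0 ss ad 1 0 0 Uq.
  have h : E0 q = comb q 1 0 0 by apply/funext => f; rewrite combE; ring.
  by rewrite /co h h0 h1 h2.
have -> : co q (E1 q) = (0, 1, 0).
  have [h0 h1 h2] := co_comb hG c0 ss ad 0 1 0 Uq.
  have h : E1 q = comb q 0 1 0 by apply/funext => f; rewrite combE; ring.
  by rewrite /co h h0 h1 h2.
have -> : co q (E2 q) = (0, 0, 1).
  have [h0 h1 h2] := co_comb hG c0 ss ad 0 0 1 Uq.
  have h : E2 q = comb q 0 0 1 by apply/funext => f; rewrite combE; ring.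
  by rewrite /co h h0 h1 h2.
rewrite /curv0 /curv1 /curv2 /gam /gam0 /gam1 /gam2 /lgam1 /lgam2 /tor /par /=.
move: y.1.1 y.1.2 y.2 z.1.1 z.1.2 z.2 => y0 y1 y2 z0 z1 z2.
move: (E1 q a) (E2 q a) (E1 q b1) (E2 q b1) (E1 q b2) (E2 q b2) (a q) (b1 q) (b2 q).
move=> a1 a2 p1 p2 q1 q2 aq b1q b2q.
by field: ss.
Qed.

End Frame.

End WeylFrame.

(** * Gluing *)

Section Glue.
Context {R : realType} {M : manifold3 R} (G : M -> tvec M -> tvec M -> R).
Variables (s c e : R) (E0 : vfield M) (eta : M -> tvec M -> R).
Hypothesis hG : pseudo_metric G.
Hypothesis c0 : c != 0.
Hypothesis ss : s * s = 1.
Hypothesis etaE : forall q v, tangent q v -> eta q v = 2 * e * c * co0 G c E0 q v.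
Implicit Types (p q : M) (v w : tvec M) (X Y Z : vfield M) (f : M -> R).

(** Bundled so that one frame per point can be selected by the axiom of choice. *)
Record local_frame := LocalFrame {
  lf_dom : set M; lf_E1 : vfield M; lf_E2 : vfield M;
  lf_a : M -> R; lf_b1 : M -> R; lf_b2 : M -> R }.

Definition lf_adapted F := adapted G s c E0 (lf_dom F) (lf_E1 F) (lf_E2 F)
  (lf_a F) (lf_b1 F) (lf_b2 F).

Definition lf_conn F := frame_conn G s c e E0 (lf_E1 F) (lf_E2 F) (lf_a F) (lf_b1 F) (lf_b2 F).

Definition lf_kappa F p := lf_E1 F p (lf_b2 F) - s * lf_E2 F p (lf_b1 F)
  - s * lf_b1 F p * lf_b1 F p - lf_b2 F p * lf_b2 F p + lf_a F p.

Variable F : M -> local_frame.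
Hypothesis F_dom : forall p, lf_dom (F p) p.
Hypothesis F_adapted : forall p, lf_adapted (F p).

(** The frame chosen at [p] may vary wildly with [p]; that the result is nevertheless smooth is the
    content of [glued_connE]. *)
Definition glued_conn : connection M := fun p v Y => lf_conn (F p) p v Y.

Lemma glued_connE p q X Y : lf_dom (F p) q -> vsmooth q X -> vsmooth q Y ->
  cov glued_conn X Y q = cov (lf_conn (F p)) X Y q.
Proof.
move=> pq; apply: (weyl_unique hG) X Y.
- by move=> v; exact: (frame_extend hG c0 ss (F_adapted q) (F_dom q)).
- exact: (frame_conn_weyl_at hG c0 ss etaE (F_adapted q) (F_dom q)).
exact: (frame_conn_weyl_at hG c0 ss etaE (F_adapted p) pq).
Qed.

(** All requirements at a single point are inherited from the frame chosen there. Only smoothness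
    compares different points: near [p] the frame of [p] may be used throughout. *)
Lemma glued_conn_weyl : weyl_connection G eta glued_conn.
Proof.
have W q : weyl_at G eta glued_conn q.
  exact: (frame_conn_weyl_at hG c0 ss etaE (F_adapted q) (F_dom q)).
have vs U X q : open U -> smooth_vfield U X -> U q -> vsmooth q X by exists U.
split; last 2 first.
- move=> U X Y oU XU YU p Up; have [_ h _] := W p.
  by apply: h; [exact: vs XU Up|exact: vs YU Up].
- move=> U X Y Z oU XU YU ZU p Up; have [_ _ h] := W p.
  by apply: h; [exact: vs XU Up|exact: vs YU Up|exact: vs ZU Up].
split.
- move=> U Y oU YU p Up x v w tv tw.
  exact: (frame_conn_lin e hG (F_adapted p) x Y (F_dom p) tv tw).
- move=> U Y Z oU YU ZU p v Up tv.
  by apply: (frame_conn_add e hG c0 ss (F_adapted p) (F_dom p) tv); [exact: vs YU Up|exact: vs ZU Up].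
- move=> U f Y oU /(smooth_onP _ oU) fU YU p v Up tv.
  by apply: (frame_conn_leibniz e hG c0 ss (F_adapted p) (F_dom p) tv); [exact: fU|exact: vs YU Up].
move=> U X Y oU XU YU; apply/(smooth_vfieldP _ oU) => p Up.
have sX := vs _ _ _ oU XU Up; have sY := vs _ _ _ oU YU Up.
apply: vsmooth_near_eq (vsmooth_frame_conn e hG (F_adapted p) (F_dom p) sX sY).
near=> r; symmetry; apply: glued_connE.
- by near: r; exact: (near_ad (F_adapted p) (F_dom p)).
- by near: r; exact: near_vsmooth.
by near: r; exact: near_vsmooth.
Unshelve. all: by end_near. Qed.

Variable k : R.
Hypothesis F_kappa : forall p, k = lf_kappa (F p) p.

Lemma einstein_weyl_frame p nab : weyl_connection G eta nab ->
  (forall v w, tangent p v -> tangent p w ->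
    ricci_sym nab p v w = 1 / 3 * scalar_curvature G nab p * G p v w) <->
  k = c * (1 + s * e ^+ 2).
Proof.
move=> nW; have nC : is_connection nab by have [] := nW.
have nWa q : weyl_at G eta nab q := weyl_connection_at q nW.
have := F_kappa p; have := F_adapted p; have := F_dom p; rewrite /lf_adapted /lf_kappa.
case: (F p) => U E1 E2 a b1 b2 /= Up ad kE.
have Rs v w := @ricci_symE _ _ _ _ _ _ _ _ hG c0 ss etaE _ _ _ _ _ _ ad nab nC nWa p v w k Up.
have GE v w : tangent p v -> tangent p w -> G p v w = c * co0 G c E0 p v * co0 G c E0 p w
    + s * co1 G s E1 p v * co1 G s E1 p w + co2 G E2 p v * co2 G E2 p w.
  move=> tv tw; rewrite [in LHS](coK hG c0 ss ad Up tv) [in LHS](coK hG c0 ss ad Up tw).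
  exact: (metric_comb2 hG ad).
split=> [h|kc].
  have t0 := vsmooth_tangent (ad_E0 ad Up); have t2 := vsmooth_tangent (ad_E2 ad Up).
  have t1 := vsmooth_tangent (ad_E1 ad Up).
  (* Two diagonal entries suffice: (E0, E0) gives [S] / 3 = s c / 2, and (E2, E2) then determines
     [k]. *)
  have h0 := h _ _ t0 t0; have h2 := h _ _ t2 t2; move: h0 h2.
  rewrite !Rs// (ad_00 ad)// (ad_22 ad)// /co /co0 /co1 /co2 (metricC hG t2 t0) (metricC hG t2 t1).
  rewrite (ad_00 ad)// (ad_22 ad)// (ad_01 ad)// (ad_02 ad)// (ad_12 ad)//.
  rewrite mulVf// !mulr0 /=; set S := scalar_curvature _ _ _ => h0 h2.
  have {}h0 : s * c / 2 = 1 / 3 * S by apply: (mulIf c0); rewrite -h0; ring.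
  have {}h2 : s * (k - c / 2 - s * c * e * e) = s * (c / 2).
    by rewrite mulrA h0 -[RHS]mulr1 -h2; ring.
  have {}h2 : (s * s) * (k - c / 2 - s * c * e * e) = (s * s) * (c / 2).
    by rewrite -!(mulrA s s) h2.
  by rewrite ss !mul1r in h2; lra.
(* For this [k] the coefficient k - c / 2 - s c e^2 is c / 2, that is s times s c / 2, so the
   symmetric Ricci form is s c / 2 times [G]. *)
have main v w : tangent p v -> tangent p w -> ricci_sym nab p v w = s * c / 2 * G p v w.
  by move=> tv tw; rewrite Rs// GE// /co /= kc; field: ss.
rewrite (@scalar_curvature_einstein _ _ _ _ _ (s * c / 2))//.
  by move=> v w tv tw; rewrite main//; field.
by eexists; exact: (frame_basis3 hG c0 ss ad Up).
Qed.

End Glue.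

(** * Adapted frames of a contact structure *)

Section ContactFrame.
Context {R : realType} {M : manifold3 R} {geom : geometry}.
Variable S : contact_structure M geom.
Notation sg := (sgn R geom).
Variable X0 : vfield M.
Hypothesis hX0 : reeb S X0.
Hypothesis hh : h_zero S X0.
Variables (c : R) (G : M -> tvec M -> tvec M -> R).
Hypothesis hG : is_Gc S X0 c G.
Hypothesis c0 : c != 0.
Implicit Types (p q : M) (v w : tvec M).

(** This is where h = 0 enters: it makes bracketing with [X0] skew for the metric on the plane,
    which leaves one coefficient [a]. *)
Lemma contact_adapted (kappa : M -> R) p : is_kappa S X0 kappa ->
  exists F : local_frame, [/\ lf_dom F p, lf_adapted G sg c X0 F,
      dplane S p (lf_E1 F p) /\ dplane S p (lf_E2 F p)
    & kappa p = lf_kappa sg F p].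
Proof.
move=> hk; have [hGm GD G00 G0D] := hG; have ss := sgn_sqr R geom.
have [U [X1 [X2 [oU Up onf]]]] := onframe_exists S p.
have [fr on] := onf; have [s1 s2 _] := fr.
have [sm0 br] := hX0.
have v0 q : U q -> vsmooth q X0 by move=> _; exists setT; split=> //; exact: openT.
have v1 q : U q -> vsmooth q X1 by exists U.
have v2 q : U q -> vsmooth q X2 by exists U.
have D1 q : U q -> dplane S q (X1 q) by move=> /(frame_mem fr)[].
have D2 q : U q -> dplane S q (X2 q) by move=> /(frame_mem fr)[].
have m12 q : U q -> dmetric S q (X1 q) (X2 q) = 0 by move=> /on[].
have m22 q : U q -> dmetric S q (X2 q) (X2 q) = 1 by move=> /on[].
have m11 q : U q -> dmetric S q (X1 q) (X1 q) = sg by move=> /on[].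
have sec1 : section_of (dplane S) U X1 by split.
have sec2 : section_of (dplane S) U X2 by split.
(* The coefficients are read off with [G] because [X1, X2] leaves the plane: orthogonality of [X0]
   to the plane hides its [X0] part, and smoothness of [G] gives that of the coefficients. *)
pose a q := G q (lie X0 X1 q) (X2 q).
pose b1 q := sg * G q (lie X1 X2 q) (X1 q).
pose b2 q := G q (lie X1 X2 q) (X2 q).
have nU q : U q -> \forall r \near q, U r by move=> Uq; exact: open_nbhs_nbhs.
have L01 q : U q -> dplane S q (lie X0 X1 q) by move=> Uq; have [] := br U X1 X2 oU onf q Uq.
have L02 q : U q -> dplane S q (lie X0 X2 q) by move=> Uq; have [] := br U X1 X2 oU onf q Uq.
have L12 q : U q -> dplane S q (lie X1 X2 q - X0 q).
  by move=> Uq; have [] := br U X1 X2 oU onf q Uq.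
have sD q := subspace_dplane S q.
have sb q := dmetric_symbilinear S q.
have dE q v : U q -> dplane S q v ->
    v = (sg * dmetric S q v (X1 q)) *: X1 q + dmetric S q v (X2 q) *: X2 q.
  move=> Uq Dv; have : dplane S q v := Dv; rewrite (frame_free fr Uq).2 => -[x [y ->]].
  rewrite !(bilinear_on2l _ _ (sD q) (sb q)); try by [exact: D1|exact: D2].
  rewrite m11// m22// ((sb q).1 (X2 q) (X1 q))//; try by [exact: D1|exact: D2].
  rewrite m12//; apply/funext => f; rewrite !tvecE; ring: ss.
have tX0 q : U q -> tangent q (X0 q) by move=> /v0/vsmooth_tangent.
have t12 q : U q -> tangent q (lie X1 X2 q).
  move=> Uq; rewrite -(subrK (X0 q) (lie X1 X2 q)); apply: tangent_add; last exact: tX0.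
  exact/dplane_tangent/L12.
have vl01 q : U q -> vsmooth q (lie X0 X1).
  move=> Uq; apply: vsmooth_lie; [exact: v0|exact: v1|].
  by apply: filterS (nU q Uq) => r /L01/dplane_tangent.
have vl12 q : U q -> vsmooth q (lie X1 X2).
  move=> Uq; apply: vsmooth_lie; [exact: v1|exact: v2|].
  by apply: filterS (nU q Uq) => r /t12.
(* [h = 0] on the frame; the metric is constant there, so only brackets remain. *)
have hE X Y (x : R) q : U q -> section_of (dplane S) U X -> section_of (dplane S) U Y ->
    (forall r, U r -> dmetric S r (X r) (Y r) = x) ->
    dmetric S q (lie X0 X q) (Y q) + dmetric S q (X q) (lie X0 Y q) = 0.
  move=> Uq sX sY cst; have := hh oU sX sY Uq; rewrite /hform.
  have -> : app X0 (fun r => dmetric S r (X r) (Y r)) q = 0.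
    rewrite -[RHS](tangent_cst x (tX0 q Uq)); apply: (tangent_near_eq (tX0 q Uq)).
    exact: filterS (nU q Uq).
  move=> h; lra.
have h11 q : U q -> dmetric S q (lie X0 X1 q) (X1 q) = 0.
  move=> Uq; have := hE X1 X1 sg q Uq sec1 sec1 m11.
  rewrite ((sb q).1 (X1 q))//; [move=> h; lra|exact: D1|exact: L01].
have h22 q : U q -> dmetric S q (lie X0 X2 q) (X2 q) = 0.
  move=> Uq; have := hE X2 X2 1 q Uq sec2 sec2 m22.
  rewrite ((sb q).1 (X2 q))//; [move=> h; lra|exact: D2|exact: L02].
have h12 q : U q -> dmetric S q (lie X0 X2 q) (X1 q) = - dmetric S q (lie X0 X1 q) (X2 q).
  move=> Uq; have := hE X1 X2 0 q Uq sec1 sec2 m12.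
  rewrite ((sb q).1 (X1 q))//; [move=> h; lra|exact: D1|exact: L02].
have aE q : U q -> a q = dmetric S q (lie X0 X1 q) (X2 q).
  by move=> Uq; rewrite /a GD//; [exact: L01|exact: D2].
have e01 q : U q -> lie X0 X1 q = a q *: X2 q.
  by move=> Uq; rewrite [LHS](dE q)//; [rewrite h11// mulr0 scale0r add0r aE|exact: L01].
have e02 q : U q -> lie X0 X2 q = (- sg * a q) *: X1 q.
  move=> Uq; rewrite [LHS](dE q)//; last exact: L02.
  by rewrite h22// scale0r addr0 h12// aE// mulrN mulNr.
have e12 q : U q -> lie X1 X2 q = b1 q *: X1 q + b2 q *: X2 q + X0 q.
  move=> Uq; rewrite -[LHS](subrK (X0 q)) [X in X + _](dE q)//; last exact: L12.
  rewrite -!GD; try by [exact: L12|exact: D1|exact: D2].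
  have t1 := dplane_tangent (D1 q Uq); have t2 := dplane_tangent (D2 q Uq).
  rewrite !(metricBl hGm)//; try by [exact: t12|exact: tX0].
  by rewrite !G0D ?subr0//; [exact: D2|exact: D1].
exists (LocalFrame U X1 X2 a b1 b2); split=> //; last 2 first.
- by split; [exact: D1|exact: D2].
(* As [c02_1] is - sg a, the halved combination in [kappa_expr] equals [a] for both signatures,
   which merges the two formulas. *)
- pose st := Structural (fun=> 0) a (fun q => - sg * a q) (fun=> 0) b1 b2.
  have ist : is_structural U X0 X1 X2 st.
    by move=> q Uq; split=> /=; rewrite ?scale0r ?add0r ?addr0 ?e01 ?e02 ?e12.
  rewrite (hk U X1 X2 st oU onf ist p Up) /kappa_expr /lf_kappa /app /=.
  move: (X1 p b2) (X2 p b1) (a p) (b1 p) (b2 p) => x y z u w.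
  by case: (geom) => /=; field.
split=> //=.
- by move=> q Uq; apply: (smooth_metric hGm); [exact: vl01|exact: v2].
- move=> q Uq; apply: smoothM; first exact: smooth_cst.
    by apply: (smooth_metric hGm); [exact: vl12|exact: v1].
- by move=> q Uq; apply: (smooth_metric hGm); [exact: vl12|exact: v2].
- by move=> q Uq; rewrite GD ?m11//; exact: D1.
- by move=> q Uq; rewrite GD ?m22//; exact: D2.
- by move=> q Uq; apply: G0D; exact: D1.
- by move=> q Uq; apply: G0D; exact: D2.
- by move=> q Uq; rewrite GD ?m12//; [exact: D1|exact: D2].
Qed.

End ContactFrame.

Theorem theorem3p4 (R : realType) (M : manifold3 R) (s : geometry)
    (S : contact_structure M s)
    (X0 : vfield M) (hX0 : reeb S X0)
    (kappa : M -> R) (hkappa : is_kappa S X0 kappa)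
    (k : R) (hconst : forall p : M, kappa p = k)
    (hh : h_zero S X0)
    (alpha : M -> tvec M -> R) (halpha : is_alpha S X0 alpha)
    (c eps : R) (hc : c <> 0)
    (G : M -> tvec M -> tvec M -> R) (hG : is_Gc S X0 c G) :
  (k = 0 ->
    (defines_einstein_weyl G (fun p v => 2 * eps * c * alpha p v) <->
     s = SubLorentzian /\ eps ^+ 2 = 1)) /\
  (k <> 0 ->
    (defines_einstein_weyl G (fun p v => 2 * eps * c * alpha p v) <->
     match s with
     | SubRiemannian => c = k / (1 + eps ^+ 2)
     | SubLorentzian => eps ^+ 2 <> 1 /\ c = k / (1 - eps ^+ 2)
     end)).
Proof.
have c0 : c != 0 by apply/eqP.
have [hGm GD G00 G0D] := hG; have [[alin _] aD a1] := halpha.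
have ss := sgn_sqr R s.
have /choice[F HF] p := contact_adapted hX0 hh hG p hkappa.
have Fd p : lf_dom (F p) p by have [] := HF p.
have Fa p : lf_adapted G (sgn R s) c X0 (F p) by have [] := HF p.
have Fk p : k = lf_kappa (sgn R s) (F p) p by have [_ _ _ <-] := HF p.
(* Both [alpha] and the [X0]-coordinate vanish on the plane and are 1 on [X0]. *)
have etaE q v : tangent q v -> 2 * eps * c * alpha q v = 2 * eps * c * co0 G c X0 q v.
  move=> tv; congr (_ * _); have [_ _ [D1 D2] _] := HF q.
  have sD := subspace_dplane S q.
  have D12 := sD.2 (co1 G (sgn R s) (lf_E1 (F q)) q v) (co2 G (lf_E2 (F q)) q v) _ _ D1 D2.
  have tX0 : tangent q (X0 q) by have [[sm _] _] := hX0; exact: sm.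
  rewrite [in LHS](coK hGm c0 ss (Fa q) (Fd q) tv) /comb -addrA -[X in _ + X]scale1r.
  rewrite (linear_on2 _ _ (@subspace_tangent _ _ q) (alin q)); last 2 first.
  - by have [sm _] := hX0.1; exact: sm.
  - exact: dplane_tangent D12.
  by rewrite a1 aD// mulr1 mulr0 addr0.
have EW : defines_einstein_weyl G (fun p v => 2 * eps * c * alpha p v) <->
    k = c * (1 + sgn R s * eps ^+ 2).
  split=> [[nab nW ew]|kc].
    have [p _] := carrier_nonempty M.
    exact: (einstein_weyl_frame hGm c0 ss etaE Fd Fa Fk p nW).1 (ew p).
  have nW := glued_conn_weyl hGm c0 ss etaE Fd Fa.
  by eexists; [exact: nW|move=> p; exact: (einstein_weyl_frame hGm c0 ss etaE Fd Fa Fk p nW).2].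
(* What remains is arithmetic on k = c (1 + sg eps^2). Positivity of 1 + eps^2 excludes k = 0 in the
   sub-Riemannian case and permits the division; for sg = -1, a nonzero [k] itself forces eps^2 to
   differ from 1. *)
rewrite EW; have e1 : 0 < 1 + eps ^+ 2 by rewrite ltr_pwDl ?sqr_ge0.
split=> [->|k0]; case: (s) => /=.
- rewrite mul1r; split=> [/esym/eqP|[]//].
  by rewrite mulf_eq0 (negbTE c0) gt_eqF.
- rewrite mulN1r; split=> [/esym/eqP|[_ ->]]; last by rewrite subrr mulr0.
  by rewrite mulf_eq0 (negbTE c0) subr_eq0 => /eqP <-.
- by rewrite mul1r; split=> [->|->]; field; rewrite gt_eqF.
rewrite mulN1r; split=> [kc|[/eqP e2 ->]].
  have e2 : eps ^+ 2 <> 1 by move=> e2; apply: k0; rewrite kc e2 subrr mulr0.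
  by split=> //; rewrite kc mulfK// subr_eq0 eq_sym; exact/eqP.
by rewrite divfK// subr_eq0 eq_sym.
Qed.
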